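(* Let $\Gamma$ be a finite connected network and let $h:\Gamma\to\mathbb{R}$ be continuous. For a constant $c<0$ consider the Kazdan-Warner problem $$(KW_c)\qquad\begin{cases}\partial^2 u=c-he^u & \text{on } e_j,\ j\in J,\\ u_j(v_i)=u_k(v_i) & j,k\in Inc_i,\ v_i\in V,\\ \sum_{j\in Inc_i}\partial_j u(v_i)=0 & v_i\in V.\end{cases}$$ Then: (i) If $(KW_c)$ has a solution for some $c<0$, then $\int_\Gamma h\,dx<0$. (ii) If $\int_\Gamma h\,dx<0$, then there exists a constant $c(h)\in[-\infty,0)$ such that $(KW_c)$ has a solution for every $c$ with $c(h)<c<0$ and has no solution for every $c<c(h)$. (iii) If $\int_\Gamma h\,dx<0$ and $c(h)$ is the constant in (ii), then $c(h)=-\infty$ if and only if $h\le 0$ in $\Gamma$.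
   Context: Network: $\Gamma=(V,E)$ consists of a finite collection of points (vertices) $V=\{v_i\}_{i\in I}\subset\mathbb{R}^n$ connected by a finite collection of continuous non-self-intersecting edges $E=\{e_j\}_{j\in J}$ ($J\neq\emptyset$), where any two edges can intersect only at a vertex. Each edge is parametrized by a continuous injective map $\pi_j:[0,l_j]\to\mathbb{R}^n$, $l_j>0$, whose endpoints $\pi_j(0),\pi_j(l_j)$ are vertices, with $e_j=\pi_j((0,l_j))$ containing no vertex. $\Gamma$ is assumed connected. $Inc_i=\{j\in J: e_j\text{ is incident to }v_i\}$. For $u:\Gamma\to\mathbb{R}$, $u_j:[0,l_j]\to\mathbb{R}$ denotes the restriction of $u$ to edge $j$ in the coordinate $y=\pi_j^{-1}(x)$, and $u_j(v_i)$ means $u_j(\pi_j^{-1}(v_i))$. Derivatives $\partial u,\partial^2u$ on an edge are with respect to the coordinate $y\in(0,l_j)$. At a vertex $v_i$ and $j\in Inc_i$, the oriented derivative is $\partial_j u(v_i)=\lim_{x\in e_j,\,x\to v_i}\frac{u_j(\pi_j^{-1}(x))-u_j(\pi_j^{-1}(v_i))}{|\pi_j^{-1}(x)-\pi_j^{-1}(v_i)|}$ (derivative pointing from the vertex into the edge). $\int_\Gamma\phi\,dx=\sum_{j\in J}\int_0^{l_j}\phi_j(r)\,dr$. $u$ is continuous on $\Gamma$ if each $u_j\in C([0,l_j])$ and $u_j(v_i)=u_k(v_i)$ for all $i\in I$, $j,k\in Inc_i$. $C^2(\Gamma)$ is the space of continuous functions on $\Gamma$ with $u_j\in C^2([0,l_j])$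 for every $j$. A solution of the problem is a function $u\in C^2(\Gamma)$ satisfying it pointwise (strong solution). *)

(* Defs.v *)
From HB Require Import structures.
From mathcomp Require Import all_boot all_order all_algebra.
From mathcomp Require Import all_classical all_reals all_analysis.
Set Implicit Arguments.
Unset Strict Implicit.
Unset Printing Implicit Defensive.
Import Order.TTheory GRing.Theory Num.Theory.
Import numFieldNormedType.Exports.
Local Open Scope classical_set_scope.
Local Open Scope ring_scope.

(* The parametrizations are total functions on R, but only their values on
   `[0, len j] are meaningful. *)
Record network (R : realType) (n : nat) := Network {
  vert : finType;
  edge : finType;
  vpt : vert -> 'rV[R]_n;
  len : edge -> R;
  par : edge -> R -> 'rV[R]_n;
  edge_inhabited : exists j : edge, True;
  vpt_inj : injective vpt;
  len_gt0 : forall j, 0 < len j;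
  par_continuous : forall j, {within `[0, len j], continuous (par j)};
  par_inj : forall j, {in `[0, len j] &, injective (par j)};
  par_source : forall j, exists i, par j 0 = vpt i;
  par_target : forall j, exists i, par j (len j) = vpt i;
  par_interior : forall j, par j @` `]0, len j[ `&` range vpt = set0;
  par_disjoint : forall j k, j != k ->
    par j @` `[0, len j] `&` par k @` `[0, len k] `<=` range vpt;
  network_connected :
    connected (range vpt `|` \bigcup_j (par j @` `]0, len j[))
}.

Section Network.
Context {R : realType} {n : nat}.
Implicit Types (G : network R n) (u h : 'rV[R]_n -> R).

Definition open_edge G (j : edge G) : set 'rV[R]_n := par j @` `]0, len j[.

Definition network_set G : set 'rV[R]_n :=
  range (@vpt R n G) `|` \bigcup_j @open_edge G j.

(* A loop is impossible since par j is injective on the closed interval, so an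
   edge is counted at most once at each vertex. *)
Definition incident G (i : vert G) (j : edge G) : bool :=
  (par j 0 == vpt i) || (par j (len j) == vpt i).

(* The inverse of par j : [0, len j] -> R^n; it is 0 off the closed edge. *)
Definition edge_coord G (j : edge G) (x : 'rV[R]_n) : R :=
  xget 0 [set y | y \in `[0, len j] /\ par j y = x].

(* Functions on the network are total functions on R^n of which only the
   values on [network_set G] are used; [restr u j] is u_j. *)
Definition restr G u (j : edge G) : R -> R := fun y => u (par j y).

Definition vertex_compatible G u : Prop :=
  forall (i : vert G) (j k : edge G), incident i j -> incident i k ->
    restr u j (edge_coord j (vpt i)) = restr u k (edge_coord k (vpt i)).

Definition network_continuous G u : Prop :=
  (forall j : edge G, {within `[0, len j], continuous (restr u j)}) /\
  vertex_compatible G u.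

(* C^2 up to the boundary: the first two derivatives on the open interval
   extend continuously to the closed one.  The values of f outside [0, l]
   play no role. *)
Definition C2_segment (l : R) (f : R -> R) : Prop :=
  [/\ {within `[0, l], continuous f},
      {in `]0, l[, forall y, derivable f y 1},
      {in `]0, l[, forall y, derivable (derive1 f) y 1} &
      forall k, (1 <= k <= 2)%N -> exists g : R -> R,
        {within `[0, l], continuous g} /\ {in `]0, l[, derive1n k f =1 g}].

Definition network_C2 G u : Prop :=
  network_continuous G u /\
  forall j : edge G, C2_segment (len j) (restr u j).

(* Derivative at the vertex i along the edge j, oriented into the edge. *)
Definition oriented_derivative G u (i : vert G) (j : edge G) : R :=
  lim ((fun x => (restr u j (edge_coord j x) -
                  restr u j (edge_coord j (vpt i))) /
                 `|edge_coord j x - edge_coord j (vpt i)|)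
       @ within (open_edge j) (nbhs (vpt i))).

Definition network_integral G u : R :=
  \sum_(j : edge G)
    \int[lebesgue_measure]_(r in `[0, len j]) restr u j r.

Definition KW_solution G h (c : R) u : Prop :=
  [/\ network_C2 G u,
      forall (j : edge G) (y : R), y \in `]0, len j[ ->
        derive1n 2 (restr u j) y = c - restr h j y * expR (restr u j y),
      vertex_compatible G u &
      forall i : vert G,
        \sum_(j : edge G | incident i j) oriented_derivative u i j = 0].

Definition KW_solvable G h (c : R) : Prop := exists u, KW_solution G h c u.

Definition KW_threshold G h (ch : \bar R) : Prop :=
  [/\ (ch < 0)%E,
      forall c : R, (ch < c%:E)%E -> c < 0 -> KW_solvable G h c &
      forall c : R, (c%:E < ch)%E -> ~ KW_solvable G h c].

End Network.

(* Main.v *)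
Require Import Defs.
From mathcomp Require Import all_boot all_order all_algebra.
From mathcomp Require Import all_classical all_reals all_analysis.
From mathcomp Require Import ring lra.
Import Order.TTheory GRing.Theory Num.Theory.
Import numFieldNormedType.Exports.
Local Open Scope classical_set_scope.
Local Open Scope ring_scope.
Set Implicit Arguments.
Unset Strict Implicit.
Unset Printing Implicit Defensive.

(** The network is replaced by a metric graph: finite sets of vertices and of
    edges, each edge being a segment from 0 to its length, with a source and a
    target.  A function on it is a family of functions on the edges that agree
    at the vertices; the Kirchhoff condition says that at each vertex the sum of
    the derivatives pointing into the edges, here called the flux, is zero.
    Every function that is C^2 up to the ends of an edge extends to the whole
    line ([C2_extension]), so all derivatives are two-sided.  The lemmas
    [KW_solvable_graph], [graph_KW_solvable] and [network_integralE] carry the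
    problem back and forth, [oriented_derivativeE] identifies the flux, and
    [vertex_connected] turns topological into combinatorial connectedness.

    On the graph, the main tool is the comparison principle [comparison]: a
    function satisfying the Kirchhoff condition and strictly concave wherever it
    is negative is nonnegative.  It gives uniqueness, hence solvability, for
    u'' = K u + g with K > 0 ([solve_coercive]), the unknowns being the vertex
    values; for K = 0 the same linear system is solvable when g has zero mean
    ([solve_mean_zero]), the kernel consisting of the constants since the graph
    is connected.

    Part (i): if u solves the problem, then h = (c - u'') e^(-u); an integration
    by parts, whose vertex terms cancel, bounds the integral of h by c times the
    integral of e^(-u) ([graph_KW_integral_lt0]).

    Part (ii): for c < 0 every very negative constant is a subsolution, so a
    supersolution gives a solution ([supersolution_solvable]): a fixed point of
    a monotone map, obtained as a supremum in a lattice of Lipschitz functions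
    without any passage to the limit.  A solution for c is a supersolution for every larger
    constant, hence the set of solvable c < 0 is an up-set and its infimum is the
    threshold.  It is nonempty: if v'' = hbar - h, where hbar < 0 is the mean of
    h, then a v + ln a is a supersolution for small a > 0 and c close to 0
    ([graph_KW_small]).

    Part (iii): if h <= 0, then a v + b is a supersolution for a = c / hbar and b
    large, whatever c < 0 ([graph_KW_nonpositive]).  If h > 0 at some point,
    then e^(-u) is at most M / |c| by comparison, where M bounds |h|, while its
    second derivative is bounded below by a positive constant near that point;
    these two facts bound |c| ([graph_KW_unsolvable]). *)

(** * Calculus on the line *)

Section Calculus.
Context {R : realType}.
Implicit Types (f g : R -> R) (x y a b : R).

(** f' is the derivative of f on the whole line. *)
Definition has_deriv f (f' : R -> R) : Prop :=
  forall y : R, is_derive y 1 f (f' y).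

Lemma is_deriveDf f g x (df dg : R) : is_derive x 1 f df ->
  is_derive x 1 g dg -> is_derive x 1 (fun y => f y + g y) (df + dg).
Proof. by move=> Hf Hg; exact: is_deriveD. Qed.

Lemma is_deriveBf f g x (df dg : R) : is_derive x 1 f df ->
  is_derive x 1 g dg -> is_derive x 1 (fun y => f y - g y) (df - dg).
Proof. by move=> Hf Hg; exact: is_deriveB. Qed.

Lemma is_deriveMf f g x (df dg : R) : is_derive x 1 f df ->
  is_derive x 1 g dg ->
  is_derive x 1 (fun y => f y * g y) (df * g x + f x * dg).
Proof.
move=> Hf Hg; have -> : df * g x + f x * dg = f x *: dg + g x *: df.
  by rewrite addrC /GRing.scale /= (mulrC df).
exact: is_deriveM.
Qed.

Lemma is_deriveZf f x (k df : R) : is_derive x 1 f df ->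
  is_derive x 1 (fun y => k * f y) (k * df).
Proof. by move=> Hf; exact: (@is_deriveZ R R R f k x 1 df). Qed.

Lemma is_derive_affine x (p q : R) : is_derive x 1 (fun y => p * y + q) p.
Proof.
have := is_deriveDf (is_deriveZf p (is_derive_id x (1 : R)))
  (is_derive_cst (q : R) x 1).
by rewrite mulr1 addr0.
Qed.

Lemma is_derive_exp f x (df : R) : is_derive x 1 f df ->
  is_derive x 1 (fun y => expR (f y)) (expR (f x) * df).
Proof.
move=> Hf; exact: (@is_derive1_comp R expR f x (expR (f x)) df).
Qed.

Lemma has_deriv_eq f (f' g' : R -> R) :
  has_deriv f f' -> f' =1 g' -> has_deriv f g'.
Proof. by move=> H E y; rewrite -E. Qed.

Lemma has_derivD f g (f' g' : R -> R) : has_deriv f f' -> has_deriv g g' ->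
  has_deriv (fun y => f y + g y) (fun y => f' y + g' y).
Proof. by move=> Hf Hg y; exact: is_deriveDf. Qed.

Lemma has_derivB f g (f' g' : R -> R) : has_deriv f f' -> has_deriv g g' ->
  has_deriv (fun y => f y - g y) (fun y => f' y - g' y).
Proof. by move=> Hf Hg y; exact: is_deriveBf. Qed.

Lemma has_derivM f g (f' g' : R -> R) : has_deriv f f' -> has_deriv g g' ->
  has_deriv (fun y => f y * g y) (fun y => f' y * g y + f y * g' y).
Proof. by move=> Hf Hg y; exact: is_deriveMf. Qed.

Lemma has_derivZ f (f' : R -> R) k : has_deriv f f' ->
  has_deriv (fun y => k * f y) (fun y => k * f' y).
Proof. by move=> Hf y; exact: is_deriveZf. Qed.

Lemma has_deriv_affine (p q : R) : has_deriv (fun y => p * y + q) (fun=> p).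
Proof. by move=> y; exact: is_derive_affine. Qed.

Lemma has_deriv_exp f (f' : R -> R) : has_deriv f f' ->
  has_deriv (fun y => expR (f y)) (fun y => expR (f y) * f' y).
Proof. by move=> Hf y; exact: is_derive_exp. Qed.

Lemma has_deriv_continuous f df : has_deriv f df ->
  continuous f.
Proof.
by move=> Hf x; apply/differentiable_continuous/derivable1_diffP; case: (Hf x).
Qed.

Lemma mvt f df a b : a < b -> has_deriv f df ->
  exists c, [/\ a < c, c < b & f b - f a = df c * (b - a)].
Proof.
move=> ab Hf; have [|c] := MVT ab (fun x _ => Hf x).
  exact/continuous_subspaceT/(has_deriv_continuous Hf).
by rewrite in_itv /= => /andP[ac cb] E; exists c.
Qed.

Lemma has_deriv0_cst f a b : has_deriv f (fun=> 0) -> f a = f b.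
Proof. by move=> Hf; exact: is_derive_0_is_cst. Qed.

(** A function with negative derivative at a point lies below its value there
    immediately to the right of the point. *)
Lemma is_derive_lt0_right f x df : is_derive x 1 f df -> df < 0 ->
  exists2 d, 0 < d & forall y, x < y < x + d -> f y < f x.
Proof.
move=> [dfx <-] df0.
have /cvgrPdist_lt/(_ (- 'D_1 f x)) := dfx.
rewrite oppr_gt0 => /(_ df0)[d /= d0 Hd]; exists d => // y /andP[xy yd].
have := Hd (y - x); rewrite /= sub0r normrN gtr0_norm ?subr_gt0// => Hd'.
have /Hd' : y - x < d by lra.
rewrite subr_eq0 gt_eqF// /GRing.scale /= mulr1 subrK => /(_ isT).
rewrite ltr_norml => /andP[+ _].
rewrite -/('D_1 f x) => H1.
have : (y - x)^-1 * (f y - f x) < 0 by lra.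
by rewrite pmulr_rlt0 ?invr_gt0 ?subr_gt0// subr_lt0.
Qed.

(** First- and second-order necessary conditions at a one-sided minimum. *)
Lemma min_right f df x d2 d : has_deriv f df ->
  is_derive x 1 df d2 -> 0 < d -> (forall y, x < y < x + d -> f x <= f y) ->
  0 <= df x /\ (df x = 0 -> 0 <= d2).
Proof.
move=> Hf Hdf d0 Hmin; split.
  rewrite leNgt; apply/negP => /(is_derive_lt0_right (Hf x))[e e0 He].
  pose y := x + Num.min d e / 2.
  have m0 : 0 < Num.min d e by rewrite lt_min d0.
  have me : Num.min d e <= e by rewrite ge_min lexx orbT.
  have md : Num.min d e <= d by rewrite ge_min lexx.
  have /He : x < y < x + e by apply/andP; split; rewrite /y; lra.
  have /Hmin : x < y < x + d by apply/andP; split; rewrite /y; lra.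
  by move=> H1 H2; lra.
move=> dfx0; rewrite leNgt; apply/negP => /(is_derive_lt0_right Hdf)[e e0].
rewrite dfx0 => He.
pose m := Num.min d e.
have m0 : 0 < m by rewrite lt_min d0.
have me : m <= e by rewrite ge_min lexx orbT.
have md : m <= d by rewrite ge_min lexx.
have xm : x < x + m / 2 by lra.
have [c [xc cm E]] := mvt xm Hf.
have : df c < 0 by apply: He; apply/andP; split; lra.
have : f x <= f (x + m / 2) by apply: Hmin; apply/andP; split; lra.
move=> H1 H2; have : df c * (x + m / 2 - x) < 0 by rewrite nmulr_rlt0//; lra.
by rewrite -E; lra.
Qed.

Lemma is_derive_reflect f x df : is_derive (- x) 1 f df ->
  is_derive x 1 (fun y => f (- y)) (- df).
Proof.
move=> Hf; have := @is_derive1_comp R f -%R x df (-1) Hf.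
rewrite mulrN1; apply; exact: is_deriveNid.
Qed.

Lemma min_left f df x d2 d : has_deriv f df ->
  is_derive x 1 df d2 -> 0 < d -> (forall y, x - d < y < x -> f x <= f y) ->
  df x <= 0 /\ (df x = 0 -> 0 <= d2).
Proof.
move=> Hf Hdf d0 Hmin.
have Hg y : is_derive y 1 (fun z => f (- z)) (- df (- y)).
  exact: is_derive_reflect.
have Hg' : is_derive (- x) 1 (fun y => - df (- y)) d2.
  rewrite -(opprK d2); apply: is_deriveN.
  by apply: is_derive_reflect; rewrite opprK.
have [|] := @min_right _ _ (- x) d2 d Hg Hg' d0.
  by move=> y Hy; rewrite opprK; apply: Hmin; lra.
by rewrite opprK oppr_ge0 => H1 H2; split => // E; apply: H2; rewrite E oppr0.
Qed.

(** The integral from a is an antiderivative to the right of a only. *)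
Lemma antiderivative_right (G : R -> R) (a : R) : continuous G ->
  exists F, forall x, a < x -> is_derive x 1 F (G x).
Proof.
move=> cG; exists (fun x => \int[lebesgue_measure]_(t in `[a, x]) G t)%R => x ax.
have xx1 : x < x + 1 by rewrite ltrDl.
have [|dF Fx] := @continuous_FTC1_closed R G a x (x + 1) xx1 _ ax (cG x).
  apply: continuous_compact_integrable; first exact: segment_compact.
  exact: continuous_subspaceT.
by apply: DeriveDef => //; rewrite -derive1E.
Qed.

Lemma antiderivative (G : R -> R) : continuous G ->
  exists F, has_deriv F G.
Proof.
move=> cG.
have /choice[H HH] := fun a => antiderivative_right a cG.
pose F y := H (- `|y| - 1) y - H (- `|y| - 1) 0.
exists F => x; pose N := - `|x| - 2.
have xN : N < x by rewrite /N; have := ler_norm (- x); rewrite normrN; lra.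
(* the antiderivatives on two half-lines differ by a constant *)
have E a b y : a <= b -> b < y -> b < 0 -> H a y - H a 0 = H b y - H b 0.
  move=> ab byy b0.
  wlog suff W : / forall u v, b < u -> u < v ->
      H a u - H b u = H a v - H b v.
    have [y0|y0|<-] := ltgtP y 0; last by rewrite !subrr.
      by have := W y 0 byy y0; lra.
    by have := W 0 y b0 y0; lra.
  move=> u v bu uv.
  have D z : b < z -> is_derive z 1 (fun t => H a t - H b t) 0.
    move=> bz; rewrite -(subrr (G z)).
    by apply: is_deriveBf; apply: HH => //; exact: le_lt_trans bz.
  have [||c _] := @MVT R (fun t => H a t - H b t) (fun=> 0) u v uv.
  - by move=> z; rewrite in_itv /= => /andP[uz _]; apply: D; exact: lt_trans uz.
  - apply: derivable_within_continuous => z; rewrite in_itv /= => /andP[uz _].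
    by have [] := D z (lt_le_trans bu uz).
  by rewrite mul0r => /eqP; rewrite subr_eq0 eq_sym => /eqP.
apply: (@near_eq_is_derive _ _ _ (fun y => H N y - H N 0)); last first.
  by rewrite -(subr0 (G x)); apply: is_deriveBf; exact: HH.
near=> y; rewrite /F; apply: E.
- have : `|x - y| < 1 by near: y; apply: nbhsx_ballx.
  rewrite /N.
  have := lerB_dist y x; rewrite (distrC y); lra.
- by have := ler_norm (- y); rewrite normrN; lra.
- by have := normr_ge0 y; lra.
Unshelve. all: by end_near. Qed.
End Calculus.

(** * Functions on a segment *)

Section Segment.
Context {R : realType}.
Implicit Types (f g : R -> R) (l x y : R).

(** The retraction of the line onto the segment from 0 to l; composing with it
    extends a continuous function on the segment to the whole line. *)
Definition clamp l y : R := Num.max 0 (Num.min y l).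

Lemma clamp_in l y : 0 <= l -> 0 <= clamp l y <= l.
Proof.
move=> l0; rewrite /clamp le_max lexx /= ge_max l0 /= ge_min lexx.
by rewrite orbT.
Qed.

Lemma clamp_id l y : 0 <= y <= l -> clamp l y = y.
Proof. by move=> /andP[y0 yl]; rewrite /clamp min_l// max_r. Qed.

Lemma clamp_continuous l : continuous (clamp l).
Proof.
move=> y.
apply: (@continuous_max R R (cst 0) (fun z => Num.min z l)).
  exact: cst_continuous.
by apply: (@continuous_min R R id (cst l)); [exact: cvg_id|exact: cst_continuous].
Qed.

Lemma continuous_clamp l f : 0 <= l -> {within `[0, l], continuous f} ->
  continuous (fun y => f (clamp l y)).
Proof.
move=> l0 /subspace_continuousP cf y.
have yl := clamp_in y l0.
have /cf : `[0, l]%classic (clamp l y) by rewrite /= in_itv.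
apply: cvg_trans; rewrite /continuous_at => A HA.
have : \forall z \near y, `[0, l]%classic (clamp l z) -> A (f (clamp l z)).
  exact: (clamp_continuous HA).
by apply: filterS => z; apply; rewrite /= in_itv /= clamp_in.
Qed.

Lemma bounded_on_segment l f : 0 <= l -> {within `[0, l], continuous f} ->
  exists M, forall y, 0 <= y <= l -> `|f y| <= M.
Proof.
move=> l0 cf; have [a _ Ha] := EVT_max l0 cf; have [b _ Hb] := EVT_min l0 cf.
exists (`|f a| + `|f b|) => y yl; rewrite ler_norml.
have := Ha y; have := Hb y; rewrite !in_itv /= yl => /(_ isT) H1 /(_ isT) H2.
have := ler_norm (f a); have := ler_norm (- f b); rewrite normrN.
have := normr_ge0 (f a); have := normr_ge0 (f b) => *.
by apply/andP; split; lra.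
Qed.

Lemma lipschitz_within_continuous l L f :
  (forall y z, 0 <= y <= l -> 0 <= z <= l -> `|f y - f z| <= L * `|y - z|) ->
  {within `[0, l], continuous f}.
Proof.
move=> H; apply/subspace_continuousP => x /=; rewrite in_itv /= => xl.
apply/cvgrPdist_lt => e e0.
have d0 : 0 < e / (`|L| + 1) by rewrite divr_gt0// ltr_wpDl.
rewrite near_withinE; near=> y; rewrite /= in_itv /= => yl.
apply: le_lt_trans (H _ _ xl yl) _.
have xy : `|x - y| < e / (`|L| + 1) by near: y; exact: nbhsx_ballx.
move: xy; rewrite ltr_pdivlMr ?ltr_wpDl// => xy.
have := normr_ge0 (x - y); have := ler_norm L => H1 H2.
have : (L - `|L|) * `|x - y| <= 0 by rewrite mulr_le0_ge0// subr_le0.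
by rewrite mulrBl mulrDr mulr1 in xy *; nra.
Unshelve. all: by end_near. Qed.

Lemma zero_derive_open l f : (forall y, 0 < y < l -> is_derive y 1 f 0) ->
  exists k, forall y, 0 < y < l -> f y = k.
Proof.
move=> Hf; exists (f (l / 2)).
have W u v : 0 < u -> u < v -> v < l -> f u = f v.
  move=> u0 uv vl.
  have [z||c _] := @MVT R f (fun=> 0) u v uv.
  - by rewrite in_itv /= => /andP[??]; apply: Hf; apply/andP; split; lra.
  - apply: derivable_within_continuous => z; rewrite in_itv /= => /andP[??].
    by have [] : is_derive z 1 f 0 by apply: Hf; apply/andP; split; lra.
  - by rewrite mul0r => /eqP; rewrite subr_eq0 eq_sym => /eqP.
move=> y /andP[y0 yl]; have [yh|yh|->//] := ltgtP y (l / 2).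
  by apply: W => //; lra.
by symmetry; apply: W => //; lra.
Qed.

Lemma zero_derive_closed l f : {within `[0, l], continuous f} ->
  (forall y, 0 < y < l -> is_derive y 1 f 0) ->
  forall y, 0 <= y <= l -> f y = f 0.
Proof.
move=> cf Hf y /andP[y0 yl]; have [->//|yn0] := eqVneq y 0.
have y0' : 0 < y by rewrite lt_def yn0.
have [z||c _] := @MVT R f (fun=> 0) 0 y y0'.
- by rewrite in_itv /= => /andP[??]; apply: Hf; apply/andP; split; lra.
- apply: continuous_subspaceW cf => z; rewrite /= !in_itv /= => /andP[-> ?] /=; lra.
- by rewrite mul0r => /eqP; rewrite subr_eq0 => /eqP.
Qed.

(** A function that is twice differentiable inside the segment, continuous up
    to the endpoints, and whose second derivative is the restriction of a
    continuous function g, extends to a function on the line with second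
    derivative g everywhere. *)
Lemma C2_extension l f g : 0 < l -> {within `[0, l], continuous f} ->
  {in `]0, l[, forall y, derivable f y 1} ->
  {in `]0, l[, forall y, derivable (derive1 f) y 1} ->
  continuous g -> (forall y, y \in `]0, l[ -> derive1n 2 f y = g y) ->
  exists F F', [/\ has_deriv F F',
    has_deriv F' g & forall y, 0 <= y <= l -> F y = f y].
Proof.
move=> l0 cf df ddf cg Hg.
have [G1 HG1] := antiderivative cg.
have [G0 HG0] := antiderivative (has_deriv_continuous HG1).
have df' y : 0 < y < l -> is_derive y 1 f (derive1 f y).
  by move=> yl; apply: DeriveDef; [apply: df|rewrite derive1E].
have ddf' y : 0 < y < l -> is_derive y 1 (derive1 f) (g y).
  move=> yl; have E2 := Hg y yl.
  by apply: DeriveDef; [exact: ddf|rewrite -E2 derive1nS /= derive1E].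
have [|a Ha] := @zero_derive_open l (fun y => derive1 f y - G1 y).
  by move=> y yl; rewrite -(subrr (g y)); exact: is_deriveBf (ddf' y yl) (HG1 y).
pose F b y := G0 y + (a * y + b).
have dF b : has_deriv (F b) (fun y => G1 y + a).
  exact: has_derivD HG0 (has_deriv_affine a b).
have Hb : forall y, 0 <= y <= l -> f y - F 0 y = f 0 - F 0 0.
  apply: (@zero_derive_closed l (fun y => f y - F 0 y)).
    apply: within_continuousB => //.
    exact/(continuous_subspaceT (f := F 0))/(has_deriv_continuous (dF 0)).
  move=> y yl; have D := is_deriveBf (df' y yl) (dF 0 y).
  suff E1 : derive1 f y - (G1 y + a) = 0 by rewrite E1 in D.
  by rewrite -(Ha _ yl); ring.
exists (F (f 0 - G0 0)), (fun y => G1 y + a); split; first exact: dF.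
- move=> y; have D := is_deriveDf (HG1 y) (is_derive_cst a y 1).
  by move: D; rewrite addr0.
- by move=> y /Hb; rewrite /F; lra.
Qed.

End Segment.

(** * Linear systems *)

Section LinearSystem.
Context {R : realType} {V : finType}.

(** A linear endomorphism of the space of functions on a finite set is onto as
    soon as its kernel is trivial. *)
Lemma linear_injective_surjective (Phi : (V -> R) -> V -> R) :
  (forall a x y i, Phi (fun k => a * x k + y k) i = a * Phi x i + Phi y i) ->
  (forall x, (forall i, Phi x i = 0) -> forall i, x i = 0) ->
  forall b, exists x, forall i, Phi x i = b i.
Proof.
move=> Phi_lin Phi_inj b.
pose delta (k : V) := fun k' : V => (k' == k)%:R : R.
have Phi_ext x y : x =1 y -> Phi x = Phi y by move=> xy; congr Phi; exact/funext.
have Phi0 i : Phi (fun=> 0) i = 0.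
  have := Phi_lin (-1) (fun=> 0) (fun=> 0) i.
  rewrite (Phi_ext _ (fun=> 0)); last by move=> k; rewrite mulr0 addr0.
  by rewrite mulN1r addNr.
have PhiE x i : Phi x i = \sum_k x k * Phi (delta k) i.
  have H s : Phi (fun k => \sum_(j <- s) x j * delta j k) i =
      \sum_(j <- s) x j * Phi (delta j) i.
    elim: s => [|j s IH].
      by rewrite big_nil -[RHS](Phi0 i); congr (_ i); apply: Phi_ext => k; rewrite big_nil.
    rewrite big_cons -IH -Phi_lin; congr (_ i); apply: Phi_ext => k.
    by rewrite big_cons.
  rewrite -H; congr (_ i); apply: Phi_ext => k.
  rewrite (bigD1 k)//= /delta eqxx mulr1 big1 ?addr0// => j jk.
  by rewrite eq_sym (negbTE jk) mulr0.
pose A : 'M[R]_#|V| := \matrix_(i, j) Phi (delta (enum_val i)) (enum_val j).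
have AE (v : 'rV[R]_#|V|) i :
    (v *m A) 0 (enum_rank i) = Phi (fun k => v 0 (enum_rank k)) i.
  rewrite PhiE mxE (reindex_onto enum_rank enum_val) /=; last by move=> ? _; exact: enum_valK.
  apply: eq_big => k; first by rewrite enum_rankK eqxx.
  by rewrite mxE !enum_rankK.
have A_unit : A \in unitmx.
  rewrite -row_free_unit; apply: inj_row_free => v vA.
  apply/rowP => j; rewrite mxE -(enum_valK j).
  by apply: (Phi_inj (fun k => v 0 (enum_rank k))) => i; rewrite -AE vA mxE.
exists (fun k => ((\row_j b (enum_val j)) *m invmx A) 0 (enum_rank k)) => i.
by rewrite -AE mulmxKV// mxE enum_rankK.
Qed.

End LinearSystem.

(** * Metric graphs and the comparison principle *)

Section Graph.
Context {R : realType} {V E : finType}.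
Variables (src tgt : E -> V) (len : E -> R).
Hypothesis len_gt0 : forall j, 0 < len j.
Implicit Types (x : V -> R) (u : E -> R -> R).

(** A function on the metric graph with edges [0, len j] running from src j to
    tgt j is given by its values x at the vertices and by a function u j on the
    whole line for each edge j, of which only the restriction to [0, len j]
    matters.  In [edgewise x u u' u''] the functions u' j and u'' j are the first
    two derivatives of u j, on the whole line, so that no one-sided derivative
    is needed at the endpoints. *)
Definition edgewise x u u' u'' : Prop :=
  [/\ forall j, has_deriv (u j) (u' j),
      forall j, has_deriv (u' j) (u'' j),
      forall j, u j 0 = x (src j) &
      forall j, u j (len j) = x (tgt j)].

(** The sum over the edges at i of the derivatives pointing into the edge. *)
Definition flux u' (i : V) : R :=
  \sum_(j | src j == i) u' j 0 - \sum_(j | tgt j == i) u' j (len j).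

(** C^2 functions on the metric graph satisfying the Kirchhoff condition. *)
Definition kirchhoff_C2 x u u' u'' : Prop :=
  edgewise x u u' u'' /\ forall i, flux u' i = 0.

Lemma len_ge0 j : 0 <= len j. Proof. exact: ltW. Qed.

(** The total flux, weighted by a function on the vertices, is a sum over the
    edges. *)
Lemma sum_flux x u' : \sum_i x i * flux u' i =
  \sum_j (x (src j) * u' j 0 - x (tgt j) * u' j (len j)).
Proof.
rewrite /flux sumrB; under eq_bigr do rewrite mulrBr !mulr_sumr.
rewrite sumrB; congr (_ - _).
  rewrite (partition_big src xpredT)//=; apply: eq_bigr => i _.
  by apply: eq_bigr => j /eqP->.
rewrite (partition_big tgt xpredT)//=; apply: eq_bigr => i _.
by apply: eq_bigr => j /eqP->.
Qed.

Lemma flux_linear (a : R) (f g : E -> R -> R) i :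
  flux (fun j y => a * f j y + g j y) i = a * flux f i + flux g i.
Proof.
by rewrite /flux !big_split /= -!mulr_sumr; ring.
Qed.

Lemma flux0 i : flux (fun _ _ => 0) i = 0.
Proof. by rewrite /flux !big1// subr0. Qed.

(** Comparison principle: a function with nonpositive flux at the vertices
    whose second derivative is negative wherever the function is negative is
    nonnegative.  At a negative minimum located at a vertex all the derivatives
    pointing into the edges are nonnegative, hence zero, and the second-order
    condition fails as in the interior. *)
Lemma comparison x d d' d'' : edgewise x d d' d'' ->
  (forall i, flux d' i <= 0) ->
  (forall j y, 0 <= y <= len j -> d j y < 0 -> d'' j y < 0) ->
  forall j y, 0 <= y <= len j -> 0 <= d j y.
Proof.
move=> [d1 d2 d0 dl] Hflux Hneg j y jy; rewrite leNgt; apply/negP => djy.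
have /choice[c Hc] : forall k, exists c, (0 <= c <= len k) /\
    forall t, 0 <= t <= len k -> d k c <= d k t.
  move=> k; have [|c] := @EVT_min R (d k) 0 (len k) (len_ge0 k).
    exact/continuous_subspaceT/(has_deriv_continuous (d1 k)).
  by rewrite in_itv /= => c1 c2; exists c; split => // t tk; apply: c2; rewrite in_itv.
(* m is the minimum of d over all edges, attained at the point c k of k *)
have [k _ Hk] := @arg_minP _ R E j xpredT (fun k => d k (c k)) isT.
set m := d k (c k).
have mmin i t : 0 <= t <= len i -> m <= d i t.
  by move=> ti; apply: le_trans (Hk i isT) _; exact: (Hc i).2.
have m0 : m < 0 by apply: le_lt_trans djy; exact: mmin.
have R0 i : d i 0 = m -> 0 <= d' i 0 /\ (d' i 0 = 0 -> 0 <= d'' i 0).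
  move=> E0; apply: (min_right (d1 i) (d2 i 0) (len_gt0 i)) => t /andP[??].
  by rewrite E0; apply: mmin; apply/andP; split; lra.
have Rl i : d i (len i) = m ->
    d' i (len i) <= 0 /\ (d' i (len i) = 0 -> 0 <= d'' i (len i)).
  move=> E0; apply: (min_left (d1 i) (d2 i (len i)) (len_gt0 i)) => t /andP[??].
  by rewrite E0; apply: mmin; apply/andP; split; lra.
have vertex i : x i = m -> (forall k, src k = i -> d' k 0 = 0) /\
    (forall k, tgt k = i -> d' k (len k) = 0).
  move=> xm.
  have P1 k' : src k' == i -> 0 <= d' k' 0.
    by move=> /eqP E1; apply: (R0 _ _).1; rewrite d0 E1.
  have P2 k' : tgt k' == i -> 0 <= - d' k' (len k').
    by move=> /eqP E1; rewrite oppr_ge0; apply: (Rl _ _).1; rewrite dl E1.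
  have := Hflux i; rewrite /flux -sumrN.
  have := sumr_ge0 (index_enum E) P1; have := sumr_ge0 (index_enum E) P2.
  set A1 := \sum_(j | _) _; set A2 := \sum_(j | _) _ => S2 S1 S.
  have Z1 : A2 = 0 by lra.
  have Z2 : A1 = 0 by lra.
  split=> k' /eqP E1.
    by apply: (psumr_eq0P P1 Z1).
  by apply/eqP; rewrite -oppr_eq0; apply/eqP; apply: (psumr_eq0P P2 Z2).
have [ck _] := Hc k; have := Hneg k (c k) ck m0; rewrite ltNge => /negP; apply.
move: (ck) => /andP[+ +]; rewrite le_eqVlt => /predU1P[c0 _|c0].
  rewrite -c0; apply: (R0 k _).2; first by rewrite c0.
  by apply: (vertex (src k) _).1 => //; rewrite -d0 c0.
rewrite le_eqVlt => /predU1P[cl|cl].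
  rewrite cl; apply: (Rl k _).2; first by rewrite -cl.
  by apply: (vertex (tgt k) _).2 => //; rewrite -dl -cl.
have [||r1 r2] := @min_right _ (d k) (d' k) (c k) _ (len k - c k) (d1 k) (d2 k _).
- lra.
- by move=> t /andP[??]; apply: mmin; apply/andP; split; lra.
have [||l1 l2] := @min_left _ (d k) (d' k) (c k) _ (c k) (d1 k) (d2 k _).
- lra.
- by move=> t /andP[??]; apply: mmin; apply/andP; split; lra.
by apply: r2; apply/eqP; rewrite eq_le l1 r1.
Qed.

End Graph.

(** * Linear equations on a metric graph *)

Section LinearEdge.
Context {R : realType}.

(** The solutions s and c of u'' = K u with initial data (0, 1) and (1, 0):
    the identity and 1 for K = 0, rescaled hyperbolic sine and cosine for
    K > 0. *)
Definition fundamental_pair (K : R) (s c : R -> R) : Prop :=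
  [/\ has_deriv s c, has_deriv c (fun y => K * s y), s 0 = 0, c 0 = 1 &
      forall y, 0 < y -> 0 < s y].

Lemma fundamental_pair_exists (K : R) : 0 <= K ->
  exists s c, fundamental_pair K s c.
Proof.
rewrite le_eqVlt => /predU1P[<-|K0].
  exists (fun y => 1 * y + 0), (fun y => 0 * y + 1); split.
  - by apply: has_deriv_eq (has_deriv_affine 1 0) _ => y; rewrite mul0r add0r.
  - by apply: has_deriv_eq (has_deriv_affine 0 1) _ => y; rewrite mul0r.
  - by rewrite mulr0 addr0.
  - by rewrite mul0r add0r.
  - by move=> y; rewrite mul1r addr0.
pose k := Num.sqrt K; have k0 : 0 < k by rewrite sqrtr_gt0.
have kk : k * k = K by rewrite -expr2 sqr_sqrtr// ltW.
have De (e : R) : has_deriv (fun t => expR (e * t + 0)) (fun y => expR (e * y + 0) * e).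
  exact/has_deriv_exp/has_deriv_affine.
exists (fun y => (2 * k)^-1 * (expR (k * y + 0) - expR (- k * y + 0))).
exists (fun y => 2^-1 * (expR (k * y + 0) + expR (- k * y + 0))); split.
- apply: has_deriv_eq (has_derivZ _ (has_derivB (De k) (De (- k)))) _ => y.
  by field; rewrite gt_eqF.
- apply: has_deriv_eq (has_derivZ _ (has_derivD (De k) (De (- k)))) _ => y.
  by rewrite -kk; field; rewrite gt_eqF.
- by rewrite !mulr0 subrr mulr0.
- by rewrite !mulr0 addr0 expR0; field.
- move=> y y0; rewrite !addr0 mulr_gt0 ?invr_gt0 ?mulr_gt0// subr_gt0 ltr_expR.
  by rewrite ltr_pM2r//; lra.
Qed.

Lemma wronskian (K : R) s c : fundamental_pair K s c ->
  forall y, c y * c y - K * (s y * s y) = 1.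
Proof.
move=> [ds dc s0 c0 _] y.
have D := has_derivB (has_derivM dc dc) (has_derivZ K (has_derivM ds ds)).
have /= -> := has_deriv0_cst y 0 (has_deriv_eq D _).
  by rewrite s0 c0 mulr1 !mulr0 subr0.
by move=> z /=; ring.
Qed.

(** Variation of constants. *)
Lemma particular_solution (K : R) s c (g : R -> R) : fundamental_pair K s c ->
  continuous g -> exists p p', [/\ has_deriv p p',
    has_deriv p' (fun y => K * p y + g y) & p 0 = 0].
Proof.
move=> fp cg; have [ds dc s0 c0 _] := fp.
have [P dP] : exists P, has_deriv P (fun y => c y * g y).
  apply: antiderivative => y.
  by apply: continuousM; [exact: has_deriv_continuous dc _|exact: cg].
have [Q dQ] : exists Q, has_deriv Q (fun y => s y * g y).
  apply: antiderivative => y.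
  by apply: continuousM; [exact: has_deriv_continuous ds _|exact: cg].
exists (fun y => s y * P y - c y * Q y + Q 0 * c y).
exists (fun y => c y * P y - K * (s y * Q y) + Q 0 * (K * s y)); split.
- have D := has_derivB (has_derivM ds dP) (has_derivM dc dQ).
  by apply: has_deriv_eq (has_derivD D (has_derivZ _ dc)) _ => y; ring.
- have D := has_derivB (has_derivM dc dP) (has_derivZ K (has_derivM ds dQ)).
  apply: has_deriv_eq (has_derivD D (has_derivZ _ (has_derivZ K ds))) _ => y.
  rewrite -[X in _ = _ + X]mul1r -[X in _ = _ + X * _](wronskian fp y); ring.
- by rewrite s0 c0; ring.
Qed.

End LinearEdge.

Section LinearGraph.
Context {R : realType} {V E : finType}.
Variables (src tgt : E -> V) (len : E -> R).
Hypothesis len_gt0 : forall j, 0 < len j.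
Local Notation edgewise := (edgewise src tgt len).
Local Notation flux := (flux src tgt len).

(** Solvability of u'' = K u + g with prescribed relation between the fluxes
    and the vertex values, from uniqueness for g = 0: on each edge the solution
    is determined by its two endpoint values, so the flux condition is a square
    linear system for the vertex values. *)
Lemma linear_alternative (K tau : R) (g : E -> R -> R) : 0 <= K ->
  (forall j, continuous (g j)) ->
  (forall x u u', edgewise x u u' (fun j y => K * u j y) ->
    (forall i, flux u' i = tau * \sum_k x k) -> forall i, x i = 0) ->
  exists x u u', edgewise x u u' (fun j y => K * u j y + g j y) /\
    forall i, flux u' i = tau * \sum_k x k.
Proof.
move=> K0 cg uniq.
have [s [c fp]] := fundamental_pair_exists K0.
have [ds dc s0 c0 s_gt0] := fp.
have sl j : s (len j) != 0 by rewrite gt_eqF// s_gt0.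
have /choice[p /choice[p' Hp]] := fun j => particular_solution fp (cg j).
pose A j y := c y - c (len j) / s (len j) * s y.
pose A' j y := K * s y - c (len j) / s (len j) * c y.
pose B j y := (s (len j))^-1 * s y.
pose B' j y := (s (len j))^-1 * c y.
have dA j : has_deriv (A j) (A' j) by exact: has_derivB dc (has_derivZ _ ds).
have dA' j : has_deriv (A' j) (fun y => K * A j y).
  apply: has_deriv_eq (has_derivB (has_derivZ K ds) (has_derivZ _ dc)) _ => y.
  by rewrite /A; ring.
have dB j : has_deriv (B j) (B' j) by exact: has_derivZ.
have dB' j : has_deriv (B' j) (fun y => K * B j y).
  by apply: has_deriv_eq (has_derivZ _ dc) _ => y; rewrite mulrCA.
have dh x j := has_derivD (has_derivZ (x (src j)) (dA j)) (has_derivZ (x (tgt j)) (dB j)).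
have dh' x j := has_derivD (has_derivZ (x (src j)) (dA' j)) (has_derivZ (x (tgt j)) (dB' j)).
have A0 j : A j 0 = 1 by rewrite /A s0 c0 mulr0 subr0.
have Al j : A j (len j) = 0 by rewrite /A; field.
have B0 j : B j 0 = 0 by rewrite /B s0 mulr0.
have Bl j : B j (len j) = 1 by rewrite /B mulVf.
pose h' (x : V -> R) j y := x (src j) * A' j y + x (tgt j) * B' j y.
pose Phi x i := flux (h' x) i - tau * \sum_k x k.
have Phi_lin a x y i : Phi (fun k => a * x k + y k) i = a * Phi x i + Phi y i.
  rewrite /Phi big_split /= -mulr_sumr.
  rewrite (_ : h' _ = fun j t => a * h' x j t + h' y j t).
    by rewrite flux_linear; ring.
  by apply/funext => j; apply/funext => t; rewrite /h'; ring.
pose q' j y := p' j y - p j (len j) * B' j y.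
have [|x Hx] := linear_injective_surjective Phi_lin _ (fun i => - flux q' i).
  move=> x Hx.
  apply: (uniq x (fun j y => x (src j) * A j y + x (tgt j) * B j y) (h' x)).
    split=> j.
    - exact: dh.
    - by apply: has_deriv_eq (dh' x j) _ => y; ring.
    - by rewrite A0 B0; ring.
    - by rewrite Al Bl; ring.
  by move=> i; apply/eqP; rewrite -subr_eq0; apply/eqP; exact: Hx.
exists x, (fun j y => (p j y - p j (len j) * B j y) +
  (x (src j) * A j y + x (tgt j) * B j y)).
exists (fun j y => 1 * q' j y + h' x j y); split; last first.
  move=> i; rewrite flux_linear; have := Hx i; rewrite /Phi.
  move: (flux q' i) (flux (h' x) i) (tau * _) => a1 a2 a3; lra.
split=> j.
- have [dp _ _] := Hp j.
  have D := has_derivB dp (has_derivZ (p j (len j)) (dB j)).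
  by apply: has_deriv_eq (has_derivD D (dh x j)) _ => y; rewrite mul1r.
- have [_ dp' _] := Hp j.
  have D := has_derivB dp' (has_derivZ (p j (len j)) (dB' j)).
  by apply: has_deriv_eq (has_derivD (has_derivZ 1 D) (dh' x j)) _ => y; ring.
- by have [_ _ p0] := Hp j; rewrite p0 A0 B0; ring.
- by rewrite Al Bl; ring.
Qed.

Variable (j0 : E).
Hypothesis graph_connected : forall S : V -> Prop,
  (forall j, S (src j) <-> S (tgt j)) -> (exists i, S i) -> forall i, S i.

Lemma solve_coercive (K : R) (g : E -> R -> R) : 0 < K ->
  (forall j, continuous (g j)) ->
  exists x u u', kirchhoff_C2 src tgt len x u u' (fun j y => K * u j y + g j y).
Proof.
move=> K0 cg.
have [|x [u [u' [H1 H2]]]] := linear_alternative (tau := 0) (ltW K0) cg; last first.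
  by exists x, u, u'; split=> // i; have := H2 i; rewrite mul0r.
move=> x u u' Hu Hf.
have nonneg (v : E -> R -> R) (v' : E -> R -> R) (z : V -> R) :
    edgewise z v v' (fun j y => K * v j y) -> (forall i, flux v' i = 0) ->
    forall j y, 0 <= y <= len j -> 0 <= v j y.
  move=> Hv Hf'; apply: (comparison len_gt0 Hv) => [i|j y _ vy].
    by rewrite Hf'.
  by rewrite pmulr_rlt0.
have Hf0 i : flux u' i = 0 by rewrite Hf mul0r.
have N1 := nonneg _ _ _ Hu Hf0.
have N2 : forall j y, 0 <= y <= len j -> 0 <= - 1 * u j y.
  apply: (nonneg _ (fun j y => - 1 * u' j y) (fun i => - 1 * x i)).
    have [h1 h2 h3 h4] := Hu; split => j.
    - exact: has_derivZ.
    - by apply: has_deriv_eq (has_derivZ _ (h2 j)) _ => y; rewrite mulrCA.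
    - by rewrite h3.
    - by rewrite h4.
  move=> i; have := flux_linear src tgt len (-1) u' (fun _ _ => 0) i.
  rewrite Hf0 mulr0 add0r (_ : flux (fun _ _ => 0) i = 0); last exact: flux0.
  by move=> <-; congr (flux _ i); apply/funext=> j; apply/funext => y; rewrite addr0.
have [_ _ h3 h4] := Hu.
have Z j y : 0 <= y <= len j -> u j y = 0.
  by move=> jy; have := N1 _ _ jy; have := N2 _ _ jy; lra.
apply: (graph_connected (S := fun i => x i = 0)) => [j|].
  rewrite -h3 -h4 !Z//; by rewrite lexx ltW.
by exists (src j0); rewrite -h3 Z// lexx ltW.
Qed.

Lemma solve_mean_zero (g G : E -> R -> R) :
  (forall j, continuous (g j)) ->
  (forall j, has_deriv (G j) (g j)) ->
  \sum_j (G j (len j) - G j 0) = 0 ->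
  exists x u u', kirchhoff_C2 src tgt len x u u' g.
Proof.
move=> cg dG G0.
have V0 : #|V|%:R != 0 :> R.
  by rewrite pnatr_eq0 -lt0n; apply/card_gt0P; exists (src j0).
have sum_flux1 (v : E -> R -> R) :
    \sum_i flux v i = \sum_j (v j 0 - v j (len j)).
  have := sum_flux src tgt len (fun=> 1) v.
  under eq_bigr do rewrite mul1r; move=> ->.
  by apply: eq_bigr => j _; rewrite !mul1r.
(* a flux equal to the sum of the vertex values vanishes *)
have tau0 (v : E -> R -> R) (z : V -> R) : (forall i, flux v i = 1 * \sum_k z k) ->
    \sum_j (v j 0 - v j (len j)) = 0 -> \sum_k z k = 0.
  move=> Hv; rewrite -sum_flux1; under eq_bigr do rewrite Hv mul1r.
  rewrite sumr_const -mulr_natr => /eqP; rewrite mulf_eq0 (negbTE V0) orbF.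
  by move=> /eqP.
have cst_diff (v w dv : R -> R) a b : has_deriv v dv -> has_deriv w dv ->
    v a - w a = v b - w b.
  move=> dv1 dv2; apply: (@has_deriv0_cst _ (fun y => v y - w y)).
  by apply: has_deriv_eq (has_derivB dv1 dv2) _ => y; rewrite subrr.
have [|x [u [u' [Hu Hf]]]] := linear_alternative (tau := 1) (lexx 0) cg; last first.
  have [h1 h2 h3 h4] := Hu.
  have h2' j : has_deriv (u' j) (g j).
    by apply: has_deriv_eq (h2 j) _ => y; rewrite mul0r add0r.
  have t0 : \sum_k x k = 0.
    apply: (tau0 u' x Hf); rewrite -[RHS]oppr0 -[in RHS]G0 -sumrN.
    apply: eq_bigr => j _; have := cst_diff _ _ _ 0 (len j) (h2' j) (dG j); lra.
  by exists x, u, u'; split=> // i; rewrite Hf t0 mulr0.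
move=> x u u' [h1 h2 h3 h4] Hf.
have h2' j : has_deriv (u' j) (fun=> 0).
  by apply: has_deriv_eq (h2 j) _ => y; rewrite mul0r.
have u'c j y : u' j y = u' j 0 by exact: has_deriv0_cst.
have t0 : \sum_k x k = 0.
  by apply: (tau0 u' x Hf); rewrite big1// => j _; rewrite u'c subrr.
have slope j : x (tgt j) - x (src j) = u' j 0 * len j.
  rewrite -h3 -h4; have [c [_ _ ->]] := mvt (len_gt0 j) (h1 j).
  by rewrite u'c subr0.
have energy : \sum_j u' j 0 ^+ 2 * len j = 0.
  have := sum_flux src tgt len x u'; rewrite big1; last first.
    by move=> i _; rewrite Hf t0 !mulr0.
  move=> S; rewrite -[RHS]oppr0 [in RHS]S -sumrN; apply: eq_bigr => j _.
  by rewrite u'c -mulrBl -mulNr opprB slope; ring.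
have const j : x (tgt j) = x (src j).
  have P k : true -> 0 <= u' k 0 ^+ 2 * len k by rewrite mulr_ge0 ?sqr_ge0// ltW.
  have /eqP := psumr_eq0P P energy (i := j) isT.
  rewrite mulf_eq0 (gt_eqF (len_gt0 j)) orbF sqrf_eq0 => /eqP z.
  by have := slope j; rewrite z mul0r => /eqP; rewrite subr_eq0 => /eqP.
have all_eq : forall i, x i = x (src j0).
  by apply: graph_connected => [j|]; [rewrite const|exists (src j0)].
move: t0; under eq_bigr do rewrite all_eq.
rewrite sumr_const -mulr_natr => /eqP; rewrite mulf_eq0 (negbTE V0) orbF.
by move=> /eqP z i; rewrite all_eq.
Qed.

End LinearGraph.

(** * Bounds on derivatives *)

Section Estimates.
Context {R : realType}.
Implicit Types (f : R -> R).

Lemma derive_bounded_lipschitz l N f f' : has_deriv f f' ->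
  (forall y, 0 <= y <= l -> `|f' y| <= N) ->
  forall y z, 0 <= y <= l -> 0 <= z <= l -> `|f y - f z| <= N * `|y - z|.
Proof.
move=> df Hf y z /andP[y0 yl] /andP[z0 zl].
wlog yz : y z y0 yl z0 zl / z < y.
  move=> W; have [yz|yz|->] := ltgtP y z; last by rewrite !subrr normr0 mulr0.
    by rewrite distrC (distrC y); exact: W.
  exact: W.
have [c [zc cy ->]] := mvt yz df.
by rewrite normrM ler_wpM2r// Hf//; apply/andP; split; lra.
Qed.

(** Interpolation: bounds on a function and on its second derivative bound the
    first derivative. *)
Lemma derive_interpolation l Q N f f' f'' : 0 < l -> has_deriv f f' ->
  has_deriv f' f'' -> (forall y, 0 <= y <= l -> `|f y| <= Q) ->
  (forall y, 0 <= y <= l -> `|f'' y| <= N) ->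
  forall y, 0 <= y <= l -> `|f' y| <= 2 * Q / l + N * l.
Proof.
move=> l0 df df' Hf Hf'' y yl; have [c [c0 cl E]] := mvt l0 df.
have cin : 0 <= c <= l by rewrite !ltW.
have N0 : 0 <= N by apply: le_trans (Hf'' _ yl).
have Hl : `|f l| <= Q by apply: Hf; rewrite lexx ltW.
have H0 : `|f 0| <= Q by apply: Hf; rewrite lexx ltW.
have B1 : `|f' c| <= 2 * Q / l.
  rewrite ler_pdivlMr// -[X in _ * X](gtr0_norm l0) -normrM -[X in _ * X]subr0 -E.
  by apply: le_trans (ler_normB _ _) _; lra.
have B2 := derive_bounded_lipschitz df' Hf'' yl cin.
have B3 : N * `|y - c| <= N * l.
  by apply: ler_wpM2l => //; move/andP: yl => [??]; rewrite ler_norml; apply/andP; split; lra.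
have -> : f' y = (f' y - f' c) + f' c by ring.
by apply: le_trans (ler_normD _ _) _; lra.
Qed.

Lemma second_difference_ge (e p d : R) f f' f'' : 0 < d -> has_deriv f f' ->
  has_deriv f' f'' -> (forall y, p - d <= y <= p + d -> e <= f'' y) ->
  e * d ^+ 2 <= f (p - d) + f (p + d) - 2 * f p.
Proof.
move=> d0 df df' Hf''.
have dg : has_deriv (fun y => f' y - e * (1 * y - p)) (fun y => f'' y - e * 1).
  exact: has_derivB df' (has_derivZ e (has_deriv_affine 1 (- p))).
have dG : has_deriv (fun y => f y - e / 2 * ((1 * y - p) * (1 * y - p)))
    (fun y => f' y - e * (1 * y - p)).
  have A := has_deriv_affine (1 : R) (- p).
  apply: has_deriv_eq (has_derivB df (has_derivZ (e / 2) (has_derivM A A))) _ => y.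
  by field.
have pd : p < p + d by lra.
have dp : p - d < p by lra.
have [c1 [c1a c1b E1]] := mvt pd dG.
have [c2 [c2a c2b E2]] := mvt dp dG.
have c21 : c2 < c1 by lra.
have [c3 [c3a c3b E3]] := mvt c21 dg.
have P3 : 0 <= (f'' c3 - e * 1) * (c1 - c2).
  apply: mulr_ge0; last lra.
  have : e <= f'' c3 by apply: Hf''; apply/andP; split; lra.
  by lra.
rewrite -E3 in P3.
have := mulr_ge0 P3 (ltW d0); move: E1 E2; rewrite !mul1r.
set a1 := (f' c1 - _); set a2 := (f' c2 - _) => E1 E2 P4.
have : 0 <= a1 * (p + d - p) - a2 * (p - (p - d)) by nra.
by rewrite -E1 -E2; nra.
Qed.

Lemma expR_sub_le (s t : R) : expR t - expR s <= expR t * (t - s).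
Proof.
have := expR_ge1Dx (s - t); have -> : expR s = expR t * expR (s - t).
  by rewrite -expRD; congr expR; ring.
move=> H; have := ler_wpM2l (expR_ge0 t) H; lra.
Qed.

End Estimates.

(** * The Kazdan-Warner equation on a metric graph *)

Section Nonlinear.
Context {R : realType} {V E : finType}.
Variables (src tgt : E -> V) (len : E -> R).
Hypothesis len_gt0 : forall j, 0 < len j.
Variable (j0 : E).
Hypothesis graph_connected : forall S : V -> Prop,
  (forall j, S (src j) <-> S (tgt j)) -> (exists i, S i) -> forall i, S i.
Variable h : E -> R -> R.
Hypothesis h_continuous : forall j, continuous (h j).
Local Notation kirchhoff_C2 := (kirchhoff_C2 src tgt len).

Lemma kirchhoff_C2_linear (a : R) x u u' u'' z v v' v'' :
  kirchhoff_C2 x u u' u'' -> kirchhoff_C2 z v v' v'' ->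
  kirchhoff_C2 (fun i => a * x i + z i) (fun j y => a * u j y + v j y)
    (fun j y => a * u' j y + v' j y) (fun j y => a * u'' j y + v'' j y).
Proof.
move=> [[u1 u2 u3 u4] fu] [[v1 v2 v3 v4] fv]; split; last first.
  by move=> i; rewrite flux_linear fu fv mulr0 addr0.
split=> j; [| |by rewrite u3 v3|by rewrite u4 v4].
- exact: has_derivD (has_derivZ a (u1 j)) (v1 j).
- exact: has_derivD (has_derivZ a (u2 j)) (v2 j).
Qed.

Lemma kirchhoff_C2_cst (b : R) :
  kirchhoff_C2 (fun=> b) (fun _ _ => b) (fun _ _ => 0) (fun _ _ => 0).
Proof.
split; last by move=> i; exact: flux0.
by split=> // j y; exact: is_derive_cst.
Qed.

Lemma bounded_on_edges (f : E -> R -> R) : (forall j, continuous (f j)) ->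
  exists2 B, 0 <= B & forall j y, 0 <= y <= len j -> `|f j y| <= B.
Proof.
move=> cf; have /choice[B HB] := fun j => bounded_on_segment (ltW (len_gt0 j))
  (continuous_subspaceT (cf j)).
have B0 j : 0 <= B j by apply: le_trans (HB j 0 _); rewrite // lexx ltW.
exists (\sum_j B j); first exact: sumr_ge0.
move=> j y jy; apply: le_trans (HB j y jy) _.
by rewrite (bigD1 j)//= lerDl sumr_ge0.
Qed.

Lemma kirchhoff_comparison x d d' d'' : kirchhoff_C2 x d d' d'' ->
  (forall j y, 0 <= y <= len j -> d j y < 0 -> d'' j y < 0) ->
  forall j y, 0 <= y <= len j -> 0 <= d j y.
Proof.
by move=> [Hd fd]; apply: (comparison len_gt0 Hd) => i; rewrite fd.
Qed.

(** Solvability of the Kazdan-Warner problem on the metric graph. *)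
Definition graph_KW (c : R) : Prop := exists x u u' u'',
  kirchhoff_C2 x u u' u'' /\
  forall j y, 0 <= y <= len j -> u'' j y = c - h j y * expR (u j y).

(** For c < 0 a supersolution yields a solution.  With K large,
    t |-> c - h e^t - K t is decreasing below the supersolution p, so that the
    map T sending w to the solution v of v'' = K v + (c - h e^w - K w) is
    monotone; it preserves the functions lying between a very negative constant
    a and p whose Lipschitz constant on the edge j is L j.  These functions form
    a complete lattice, and the supremum of the w with w <= T w is a fixed point
    of T. *)
Lemma supersolution_solvable (c : R) x p p' p'' : c < 0 ->
  kirchhoff_C2 x p p' p'' ->
  (forall j y, 0 <= y <= len j -> p'' j y <= c - h j y * expR (p j y)) ->
  graph_KW c.
Proof.
move=> c0 Hp super; have [[dp _ _ _] _] := Hp.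
have [M M0 HM] := bounded_on_edges h_continuous.
have [P P0 HP] := bounded_on_edges (fun j => has_deriv_continuous (dp j)).
have pP j y : 0 <= y <= len j -> p j y <= P.
  by move=> jy; apply: le_trans (ler_norm _) (HP j y jy).
(* a is below p, and small enough for the constant a to be a subsolution *)
pose a := Num.min (- P) (ln (- c / (M + 1))).
have aP : a <= - P by rewrite ge_min lexx.
have Ma : M * expR a <= - c.
  have M1 : 0 < M + 1 by lra.
  have : expR a <= - c / (M + 1).
    rewrite -[leRHS]lnK ?posrE ?divr_gt0//; last lra.
    by rewrite ler_expR ge_min lexx orbT.
  rewrite ler_pdivlMr// => H; apply: le_trans H; have := expR_ge0 a; lra.
have ap j y : 0 <= y <= len j -> a <= p j y.
  by move=> jy; have := HP j y jy; rewrite ler_norml => /andP[? _]; lra.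
(* K exceeds the Lipschitz constant of t |-> h e^t on t <= P *)
pose K := M * expR P + 1.
have MP : 0 <= M * expR P by rewrite mulr_ge0// expR_ge0.
have K0 : 0 < K by rewrite /K; lra.
pose F j y t := c - h j y * expR t - K * t.
have F_dec j y s t : 0 <= y <= len j -> s <= t -> t <= P -> F j y t <= F j y s.
  move=> jy st tP; rewrite /F.
  have h1 : - M <= h j y by have := HM j y jy; rewrite ler_norml => /andP[].
  have e1 : 0 <= expR t - expR s by rewrite subr_ge0 ler_expR.
  have e2 := expR_sub_le s t.
  have e3 : expR t * (t - s) <= expR P * (t - s).
    by rewrite ler_wpM2r ?subr_ge0// ler_expR.
  have e4 : M * (expR t - expR s) <= M * (expR P * (t - s)).
    by apply: ler_wpM2l => //; lra.
  have e5 : 0 <= (h j y + M) * (expR t - expR s) by rewrite mulr_ge0//; lra.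
  by rewrite /K; nra.
(* Q bounds the functions between a and p, B the values of F on them, and N
   the second derivative of their images under T *)
pose Q := `|a| + P.
have bQ t : a <= t -> t <= P -> `|t| <= Q.
  move=> at_ tP; rewrite /Q ler_norml; have := ler_norm (- a); rewrite normrN.
  by have := normr_ge0 a => *; apply/andP; split; lra.
pose B := - c + M * expR P + K * Q.
have F_bd j y t : 0 <= y <= len j -> a <= t -> t <= P -> `|F j y t| <= B.
  move=> jy at_ tP; rewrite /F /B.
  have b1 : `|h j y * expR t| <= M * expR P.
    by rewrite normrM (ger0_norm (expR_ge0 t)) ler_pM ?expR_ge0// ?HM// ler_expR.
  have b2 : `|K * t| <= K * Q by rewrite normrM gtr0_norm// ler_pM2l// bQ.
  apply: le_trans (ler_normB _ _) _; apply: lerD b2.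
  by apply: le_trans (ler_normB _ _) _; rewrite ltr0_norm// lerD2l.
pose N := K * Q + B.
pose L j := 2 * Q / len j + N * len j.
pose S (w : E -> R -> R) := forall j,
  (forall y, 0 <= y <= len j -> a <= w j y <= p j y) /\
  (forall y z, 0 <= y <= len j -> 0 <= z <= len j ->
    `|w j y - w j z| <= L j * `|y - z|).
(* v is the image of w under T; the clamp makes the right-hand side continuous
   on the whole line *)
pose step (w v : E -> R -> R) := exists x v', kirchhoff_C2 x v v'
  (fun j y => K * v j y + F j y (w j (clamp (len j) y))).
have step_ex w : S w -> exists v, step w v.
  move=> Sw.
  have [|z [v [v' Hv]]] := @solve_coercive R V E src tgt len len_gt0 j0
    graph_connected K (fun j y => F j y (w j (clamp (len j) y))) K0.
    move=> j; have cw : continuous (fun y => w j (clamp (len j) y)).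
      apply: continuous_clamp; first exact: ltW.
      exact: lipschitz_within_continuous (Sw j).2.
    have ce : continuous (fun y => expR (w j (clamp (len j) y))).
      by move=> y; apply: continuous_comp; [exact: cw|exact: continuous_expR].
    move=> y; apply: cvgB; last by apply: cvgM; [exact: cvg_cst|exact: cw].
    apply: cvgB; first exact: cvg_cst.
    by apply: cvgM; [exact: h_continuous|exact: ce].
  by exists v, z, v'.
have S_le w j y : S w -> 0 <= y <= len j -> a <= w j y /\ w j y <= P.
  by move=> Sw jy; have /andP[? ?] := (Sw j).1 y jy; split=> //; apply: le_trans (pP j y jy).
have step_mono w w' v v' : S w -> S w' ->
    (forall j y, 0 <= y <= len j -> w j y <= w' j y) ->
    step w v -> step w' v' -> forall j y, 0 <= y <= len j -> v j y <= v' j y.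
  move=> Sw Sw' ww' [z [dv Hv]] [z' [dv' Hv']] j y jy.
  suff : 0 <= -1 * v j y + v' j y by lra.
  apply: (kirchhoff_comparison (kirchhoff_C2_linear (-1) Hv Hv')) jy.
  move=> {}j {}y jy; rewrite clamp_id// => neg.
  have := F_dec j y _ _ jy (ww' j y jy) (S_le w' j y Sw' jy).2.
  have : K * (v' j y - v j y) < 0 by rewrite pmulr_rlt0//; lra.
  by lra.
have step_S w v : S w -> step w v -> S v.
  move=> Sw [z [dv Hv]].
  have av j y : 0 <= y <= len j -> a <= v j y.
    move=> jy; suff : 0 <= 1 * v j y + - a by lra.
    apply: (kirchhoff_comparison (kirchhoff_C2_linear 1 Hv (kirchhoff_C2_cst (- a)))) jy.
    move=> {}j {}y jy; rewrite clamp_id// => neg.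
    have [w1 w2] := S_le w j y Sw jy.
    have := F_dec j y _ _ jy w1 w2.
    have : K * (v j y - a) < 0 by rewrite pmulr_rlt0//; lra.
    have : - M <= h j y by have := HM j y jy; rewrite ler_norml => /andP[].
    have := expR_ge0 a; rewrite {2}/F => *; nra.
  have vp j y : 0 <= y <= len j -> v j y <= p j y.
    move=> jy; suff : 0 <= -1 * v j y + p j y by lra.
    apply: (kirchhoff_comparison (kirchhoff_C2_linear (-1) Hv Hp)) jy.
    move=> {}j {}y jy; rewrite clamp_id// => neg.
    have /andP[w1 w2] := (Sw j).1 y jy.
    have := F_dec j y _ _ jy w2 (pP j y jy).
    have : K * (p j y - v j y) < 0 by rewrite pmulr_rlt0//; lra.
    by have := super j y jy; rewrite {1}/F; lra.
  move=> j; split=> [y jy|]; first by rewrite av ?vp.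
  have vQ y : 0 <= y <= len j -> `|v j y| <= Q.
    by move=> jy; apply: bQ; [exact: av|apply: le_trans (vp j y jy) (pP j y jy)].
  have [[d1 d2 _ _] _] := Hv.
  apply: (derive_bounded_lipschitz (d1 j)).
  apply: (derive_interpolation (len_gt0 j) (d1 j) (d2 j) vQ) => y jy /=.
  rewrite clamp_id//; have [w1 w2] := S_le w j y Sw jy.
  apply: le_trans (ler_normD _ _) _; apply: lerD; last exact: F_bd.
  by rewrite normrM gtr0_norm// ler_pM2l// vQ.
(* the functions w with w <= T w, and their supremum m *)
pose pre w := S w /\ exists2 v, step w v &
  forall j y, 0 <= y <= len j -> w j y <= v j y.
pose m j y := sup [set w j y | w in pre].
have L0 j : 0 <= L j.
  have Q0 : 0 <= Q by rewrite addr_ge0.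
  have B0 : 0 <= B by rewrite /B; have := mulr_ge0 (ltW K0) Q0; lra.
  by rewrite addr_ge0// ?mulr_ge0// ?invr_ge0 ?(ltW (len_gt0 j))// /N addr_ge0// mulr_ge0// ltW.
have Sa : S (fun _ _ => a).
  by move=> j; split=> [y jy|y z _ _]; [rewrite lexx ap|rewrite subrr normr0 mulr_ge0].
have pre_a : pre (fun _ _ => a).
  split=> //; have [v Hv] := step_ex _ Sa; exists v => // j y jy.
  exact: (S_le v j y (step_S _ _ Sa Hv) jy).1.
have m_ub w j y : pre w -> 0 <= y <= len j -> w j y <= m j y.
  move=> Hw jy; apply: ub_le_sup; last by exists w.
  by exists P => _ [w' [Sw' _] <-]; exact: (S_le w' j y Sw' jy).2.
have m_le j y b : (forall w, pre w -> w j y <= b) -> m j y <= b.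
  move=> Hb; apply: ge_sup; first by exists a; exists (fun _ _ => a).
  by move=> _ [w Hw <-]; exact: Hb.
have Sm : S m.
  move=> j; split=> [y jy|].
    rewrite (m_ub _ j y pre_a jy)/=; apply: m_le => w [Sw _].
    by have /andP[] := (Sw j).1 y jy.
  suff W y z : 0 <= y <= len j -> 0 <= z <= len j -> m j y <= m j z + L j * `|y - z|.
    move=> y z jy jz; rewrite ler_norml; have := W y z jy jz; have := W z y jz jy.
    by rewrite (distrC z) => *; apply/andP; split; lra.
  move=> jy jz; apply: m_le => w Hw; have := (Hw.1 j).2 y z jy jz.
  by rewrite ler_norml => /andP[_ ?]; have := m_ub w j z Hw jz; lra.
have [v Hv] := step_ex m Sm.
have mv j y : 0 <= y <= len j -> m j y <= v j y.
  move=> jy; apply: m_le => w Hw; have [Sw [vw Hvw wv]] := Hw.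
  apply: le_trans (wv j y jy) _; apply: (step_mono w m) jy => //.
  by move=> {}j {}y jy; exact: m_ub.
have Sv := step_S _ _ Sm Hv.
have pre_v : pre v.
  split=> //; have [vv Hvv] := step_ex v Sv; exists vv => //.
  exact: (step_mono m v).
have vm j y : 0 <= y <= len j -> v j y = m j y.
  by move=> jy; apply/eqP; rewrite eq_le m_ub// mv.
have [z [v' Hv']] := Hv.
exists z, v, v', (fun j y => K * v j y + F j y (m j (clamp (len j) y))).
by split=> // j y jy; rewrite clamp_id// -vm// /F; ring.
Qed.

Lemma graph_KW_up c1 c2 : c1 <= c2 -> c2 < 0 -> graph_KW c1 -> graph_KW c2.
Proof.
move=> c12 c20 [x [u [u' [u'' [Hu E1]]]]].
by apply: (supersolution_solvable c20 Hu) => j y jy; rewrite E1// lerD2r.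
Qed.

Variable H : E -> R -> R.
Hypothesis H_deriv : forall j, has_deriv (H j) (h j).

(** The integral of h over the graph, through antiderivatives. *)
Definition graph_integral : R := \sum_j (H j (len j) - H j 0).

(** The equation multiplied by e^(-u) says that the derivative of
    H + u' e^(-u) is (c - u'^2) e^(-u); the total flux of u' e^(-u)
    vanishes. *)
Lemma graph_KW_integral_lt0 c : c < 0 -> graph_KW c -> graph_integral < 0.
Proof.
move=> c0 [x [u [u' [u'' [[[d1 d2 e1 e2] fl] Hu]]]]].
have Hj j : H j (len j) - H j 0 < expR (-1 * x (src j)) * u' j 0 -
    expR (-1 * x (tgt j)) * u' j (len j).
  have D := has_derivD (H_deriv j) (has_derivM (has_deriv_exp (has_derivZ (-1) (d1 j))) (d2 j)).
  have [y [y0 yl]] := mvt (len_gt0 j) D.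
  rewrite subr0 Hu; last by rewrite !ltW.
  rewrite !e1 !e2 => EE.
  have ee : expR (-1 * u j y) * expR (u j y) = 1.
    by rewrite -expRD mulN1r addNr expR0.
  have eg := expR_gt0 (-1 * u j y).
  set e := expR (-1 * u j y) in EE ee eg.
  have : (c - u' j y ^+ 2) * e * len j < 0.
    rewrite pmulr_llt0// pmulr_llt0//; have := sqr_ge0 (u' j y); lra.
  have -> : (c - u' j y ^+ 2) * e = h j y +
      (e * (-1 * u' j y) * u' j y + e * (c - h j y * expR (u j y))).
    have hE : h j y = h j y * (e * expR (u j y)) by rewrite ee mulr1.
    by rewrite [X in _ = X + _]hE; ring.
  by rewrite -EE; lra.
have := sum_flux src tgt len (fun i => expR (-1 * x i)) u'.
rewrite big1 => [S0|i _]; last by rewrite fl mulr0.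
rewrite [ltRHS]S0 /graph_integral (bigD1 j0)//= [ltRHS](bigD1 j0)//=.
by rewrite ltr_leD// ler_sum// => j _; exact: ltW.
Qed.

(** The solution v of v'' = hbar - h, where hbar is the mean value of h. *)
Lemma mean_value_potential : graph_integral < 0 -> exists hbar x v v',
  hbar < 0 /\ kirchhoff_C2 x v v' (fun j y => hbar - h j y).
Proof.
move=> I0; have l0 : 0 < \sum_j len j.
  rewrite (bigD1 j0)//= ltr_wpDr// sumr_ge0// => j _; exact: ltW.
pose hbar := graph_integral / \sum_j len j.
have [|j||x [v [v' Hv]]] := @solve_mean_zero R V E src tgt len len_gt0 j0
    graph_connected (fun j y => hbar - h j y) (fun j y => (hbar * y + 0) - H j y).
- by move=> j y; apply: cvgB; [exact: cvg_cst|exact: h_continuous].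
- exact: has_derivB (has_deriv_affine hbar 0) (H_deriv j).
- rewrite (eq_bigr (fun j => hbar * len j - (H j (len j) - H j 0))); last first.
    by move=> j _; ring.
  by rewrite sumrB -mulr_sumr /hbar divfK ?gt_eqF// subrr.
exists hbar, x, v, v'; split=> //.
by rewrite /hbar pmulr_llt0// invr_gt0.
Qed.

Lemma graph_KW_small : graph_integral < 0 -> exists2 c, c < 0 & graph_KW c.
Proof.
move=> /mean_value_potential[hbar [x [v [v' [hb0 Hv]]]]].
have [[dv _ _ _] _] := Hv.
have [M M0 HM] := bounded_on_edges h_continuous.
have [B B0 HB] := bounded_on_edges (fun j => has_deriv_continuous (dv j)).
(* with a small, e^(a v) is eta-close to 1, so that replacing h e^(a v) by h
   costs at most a |hbar| / 2 *)
pose eta := - hbar / (2 * (M + 1)).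
have eta0 : 0 < eta by rewrite divr_gt0//; lra.
have Meta : M * eta <= - hbar / 2.
  rewrite /eta; have -> : - hbar / 2 = (M + 1) * (- hbar / (2 * (M + 1))).
    by field; lra.
  by apply: ler_wpM2r; [exact: ltW|lra].
have [d d0 Hd] : exists2 d, 0 < d & forall t, `|t| < d -> `|expR t - 1| < eta.
  have /cvgrPdist_lt/(_ _ eta0)[d /= d0 Hd] := @continuous_expR R 0.
  exists d => // t td; have := Hd t; rewrite /= sub0r normrN expR0 distrC.
  exact.
pose a := d / (2 * (B + 1)).
have a0 : 0 < a by rewrite divr_gt0//; lra.
have c0 : a * hbar / 2 < 0.
  have : 0 < a * - hbar by rewrite mulr_gt0//; lra.
  by lra.
exists (a * hbar / 2) => //; apply: (supersolution_solvable c0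
  (kirchhoff_C2_linear a Hv (kirchhoff_C2_cst (ln a)))) => j y jy.
rewrite expRD lnK ?posrE//.
have : `|expR (a * v j y) - 1| < eta.
  apply: Hd; rewrite normrM gtr0_norm//.
  apply: le_lt_trans (ler_wpM2l (ltW a0) (HB j y jy)) _.
  rewrite /a mulrAC ltr_pdivrMr; last lra.
  by nra.
set e := expR _ => /ltW He.
have : `|h j y * (e - 1)| <= M * eta by rewrite normrM ler_pM// HM.
rewrite ler_norml => /andP[_ H1].
have : a * (h j y * (e - 1)) <= a * (- hbar / 2).
  by apply: ler_wpM2l; [exact: ltW|lra].
by lra.
Qed.

Lemma graph_KW_nonpositive c : graph_integral < 0 ->
  (forall j y, 0 <= y <= len j -> h j y <= 0) -> c < 0 -> graph_KW c.
Proof.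
move=> /mean_value_potential[hbar [x [v [v' [hb0 Hv]]]]] h0 c0.
have [[dv _ _ _] _] := Hv.
have [B B0 HB] := bounded_on_edges (fun j => has_deriv_continuous (dv j)).
pose a := c / hbar.
have a0 : 0 < a by rewrite /a -mulrNN -invrN divr_gt0//; lra.
have ah : a * hbar = c by rewrite /a divfK// lt_eqF.
apply: (supersolution_solvable c0
  (kirchhoff_C2_linear a Hv (kirchhoff_C2_cst (ln a + a * B)))) => j y jy.
have : a <= expR (a * v j y + (ln a + a * B)).
  rewrite -[leLHS]lnK ?posrE// ler_expR.
  have := HB j y jy; rewrite ler_norml => /andP[H1 _].
  have : a * - B <= a * v j y by rewrite ler_pM2l.
  by lra.
set e := expR _ => ae; have := h0 j y jy => hj.
have : 0 <= - h j y * (e - a) by rewrite mulr_ge0//; lra.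
by rewrite (mulrBr a) ah; lra.
Qed.

(** Where h is positive, e^(-u) is uniformly strictly convex, while comparison
    bounds it by a multiple of 1 / -c. *)
Lemma graph_KW_unsolvable j1 y1 : 0 <= y1 <= len j1 -> 0 < h j1 y1 ->
  exists2 c, c < 0 & ~ graph_KW c.
Proof.
move=> jy1 h1.
have [M0 M00 HM0] := bounded_on_edges h_continuous.
pose M := M0 + 1; have M_gt0 : 0 < M by rewrite /M; lra.
have HM j y : 0 <= y <= len j -> - M < h j y.
  by move=> jy; have := HM0 j y jy; rewrite ler_norml /M => /andP[? _]; lra.
pose e := h j1 y1 / 2; have e0 : 0 < e by rewrite /e; lra.
(* h >= e on the interval [p - d, p + d] *)
have [p [d [d0 pd Hpd]]] : exists p d, [/\ 0 < d,
    forall y, p - d <= y <= p + d -> 0 <= y <= len j1 &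
    forall y, p - d <= y <= p + d -> e <= h j1 y].
  have /cvgrPdist_lt/(_ _ e0)[d1 /= d10 Hd1] := h_continuous (j := j1) (x := y1).
  pose m := Num.min d1 (len j1).
  have m0 : 0 < m by rewrite lt_min d10 len_gt0.
  have m1 : m <= d1 by rewrite ge_min lexx.
  have m2 : m <= len j1 by rewrite ge_min lexx orbT.
  have near_ge y : `|y1 - y| < d1 -> e <= h j1 y.
    by move=> /Hd1 /=; rewrite ltr_norml /e => /andP[_ ?]; lra.
  have [yl|yl] := leP y1 (len j1 / 2).
    exists (y1 + m / 4), (m / 4); split; first lra.
    - by move=> y /andP[??]; move/andP: jy1 => [??]; apply/andP; split; lra.
    - by move=> y /andP[??]; apply: near_ge; rewrite ltr_norml; apply/andP; split; lra.
  exists (y1 - m / 4), (m / 4); split; first lra.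
  - by move=> y /andP[??]; move/andP: jy1 => [??]; apply/andP; split; lra.
  - by move=> y /andP[??]; apply: near_ge; rewrite ltr_norml; apply/andP; split; lra.
(* for c = - k the two bounds on e^(-u) leave no room for its value at p *)
pose k := 2 * M / (e * d ^+ 2).
have ed0 : 0 < e * d ^+ 2 by rewrite mulr_gt0// exprn_gt0.
have k0 : 0 < k by rewrite divr_gt0// mulr_gt0.
exists (- k); first by rewrite oppr_lt0.
move=> [x [u [u' [u'' [Hu Eu]]]]].
have kM : 0 < k / M by rewrite divr_gt0.
pose m := ln (k / M).
have um j y : 0 <= y <= len j -> m <= u j y.
  move=> jy; suff : 0 <= 1 * u j y + - m by lra.
  apply: (kirchhoff_comparison (kirchhoff_C2_linear 1 Hu (kirchhoff_C2_cst (- m)))) jy.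
  move=> {}j {}y jy neg; rewrite Eu// mul1r addr0.
  have : expR (u j y) < k / M by rewrite -[ltRHS]lnK// ltr_expR -/m; lra.
  rewrite ltr_pdivlMr// => H1; have := HM j y jy; have := expR_gt0 (u j y).
  by nra.
have [[d1 d2 _ _] _] := Hu.
pose phi y := expR (-1 * u j1 y).
have dphi := has_deriv_exp (has_derivZ (-1) (d1 j1)).
have ddphi := has_derivM dphi (has_derivZ (-1) (d2 j1)).
have := second_difference_ge d0 dphi ddphi (e := e) (p := p).
have phi_le y : 0 <= y <= len j1 -> expR (-1 * u j1 y) <= M / k.
  move=> jy; rewrite -invf_div -[leRHS]lnK ?posrE ?invr_gt0// lnV ?posrE// ler_expR -/m.
  by have := um j1 y jy; lra.
have B1 : expR (-1 * u j1 (p - d)) <= M / k.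
  by apply: phi_le; apply: pd; apply/andP; split; lra.
have B2 : expR (-1 * u j1 (p + d)) <= M / k.
  by apply: phi_le; apply: pd; apply/andP; split; lra.
have B3 := expR_gt0 (-1 * u j1 p).
have Mk : M / k = e * d ^+ 2 / 2 by rewrite /k; field; rewrite !gt_eqF.
move=> SD; have : e * d ^+ 2 <= M / k + M / k - 2 * expR (-1 * u j1 p); last by lra.
apply: le_trans (SD _) _; last by lra.
move=> y py; have jy := pd y py; rewrite Eu//.
have ee : expR (-1 * u j1 y) * expR (u j1 y) = 1.
  by rewrite -expRD mulN1r addNr expR0.
have -> : expR (-1 * u j1 y) * (-1 * u' j1 y) * (-1 * u' j1 y) +
    expR (-1 * u j1 y) * (-1 * (- k - h j1 y * expR (u j1 y))) =
  expR (-1 * u j1 y) * (u' j1 y ^+ 2 + k) + h j1 y.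
  have hE : h j1 y = h j1 y * (expR (-1 * u j1 y) * expR (u j1 y)).
    by rewrite ee mulr1.
  by rewrite [X in _ = _ + X]hE; ring.
apply: le_trans (Hpd y py) _; rewrite lerDr mulr_ge0 ?expR_ge0//.
by rewrite addr_ge0 ?sqr_ge0// ltW.
Qed.

End Nonlinear.

(** * Combinatorics and topology of a network *)

Section Bridge.
Context {R : realType} {n : nat} (G : network R n).
Implicit Types (i : vert G) (j k : edge G) (S : vert G -> Prop).
Local Notation len := (@len R n G).

(** The vertices at the ends of an edge. *)
Definition source j : vert G := sval (cid (par_source j)).
Definition target j : vert G := sval (cid (par_target j)).

Lemma par0 j : par j 0 = vpt (source j).
Proof. by rewrite /source; case: cid. Qed.

Lemma parl j : par j (len j) = vpt (target j).
Proof. by rewrite /target; case: cid. Qed.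

Lemma par_eq j y z : 0 <= y <= len j -> 0 <= z <= len j ->
  par j y = par j z -> y = z.
Proof. by move=> jy jz; apply: par_inj; rewrite in_itv. Qed.

Lemma segment0 j : 0 <= (0 : R) <= len j.
Proof. by rewrite lexx ltW// len_gt0. Qed.

Lemma segmentl j : (0 : R) <= len j <= len j.
Proof. by rewrite lexx ltW// len_gt0. Qed.

Lemma source_target j : source j != target j.
Proof.
apply/eqP => st; have := len_gt0 j.
suff -> : len j = 0 by rewrite ltxx.
apply: (@par_eq j); rewrite ?segment0 ?segmentl//.
by rewrite par0 parl st.
Qed.

Lemma incidentE i j : incident i j = (source j == i) || (target j == i).
Proof. by rewrite /incident par0 parl !(inj_eq (@vpt_inj R n G)). Qed.

(** A closed edge meets the vertices at its two ends only. *)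
Lemma par_vertex j y i : 0 <= y <= len j -> par j y = vpt i ->
  (y = 0 /\ source j = i) \/ (y = len j /\ target j = i).
Proof.
move=> jy E; have [y0|y0] := eqVneq y 0.
  by left; split=> //; apply: vpt_inj; rewrite -par0 -y0.
have [yl|yl] := eqVneq y (len j).
  by right; split=> //; apply: vpt_inj; rewrite -parl -yl.
have : (par j @` `]0, len j[ `&` range (@vpt R n G)) (vpt i).
  split; last by exists i.
  exists y => //=; rewrite in_itv /=; move/andP: jy => [h1 h2].
  by rewrite !lt_neqAle h1 h2 yl eq_sym y0.
by rewrite par_interior.
Qed.

Lemma edges_meet j k y z : j != k -> 0 <= y <= len j -> 0 <= z <= len k ->
  par j y = par k z -> exists i, par j y = vpt i.
Proof.
move=> jk jy kz E; have [|i _ <-] := par_disjoint jk (t := par j y).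
  split; first by exists y => //=; rewrite in_itv.
  by exists z => //=; rewrite in_itv.
by exists i.
Qed.

Lemma edge_coordK j y : 0 <= y <= len j -> edge_coord j (par j y) = y.
Proof.
move=> jy; apply: xget_unique; first by split=> //; rewrite in_itv.
by move=> z [+ E]; rewrite in_itv /= => jz; exact: (@par_eq j).
Qed.

Lemma closed_edge_closed j (A : set R) : closed A ->
  closed (par j @` (`[0, len j] `&` A)).
Proof.
move=> cA; apply: compact_closed; first exact: norm_hausdorff.
apply: continuous_compact.
  apply: continuous_subspaceW (@par_continuous _ _ _ j); exact: subIsetl.
by apply: compact_closedI => //; exact: segment_compact.
Qed.

(** The subgraph formed by the vertices in S and the closed edges starting at
    them. *)
Definition subgraph S : set 'rV[R]_n :=
  (\bigcup_(i in [set i | S i]) [set vpt i]) `|`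
  (\bigcup_(j in [set j | S (source j)]) (par j @` `[0, len j])).

Lemma subgraph_closed S : closed (subgraph S).
Proof.
apply: closedU; apply: (closed_bigcup finite_finset).
- by move=> i _; apply: accessible_closed_set1; apply/hausdorff_accessible/norm_hausdorff.
- by move=> j _; rewrite -(setIT `[0, len j]%classic); exact: closed_edge_closed closedT.
Qed.

Section ClosedUnderEdges.
Variable S : vert G -> Prop.
Hypothesis S_edge : forall j, S (source j) <-> S (target j).

Lemma subgraph_vertex i : subgraph S (vpt i) -> S i.
Proof.
case=> [[i' Si'] /vpt_inj ->//|[j Sj [y]]].
rewrite /= in_itv /= => jy /(par_vertex jy)[[_ <-//]|[_ <-]].
exact/S_edge.
Qed.

End ClosedUnderEdges.

(** Combinatorial form of the connectedness of the network. *)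
Lemma vertex_connected S : (forall j, S (source j) <-> S (target j)) ->
  (exists i, S i) -> forall i, S i.
Proof.
move=> S_edge [i0 Si0] i.
have nS_edge j : ~ S (source j) <-> ~ S (target j) by have := S_edge j; tauto.
have cover p : network_set G p -> subgraph S p \/ subgraph (fun i => ~ S i) p.
  case=> [[v _ <-]|[j _ [y yj <-]]].
    by have [Sv|Sv] := EM (S v); [left|right]; left; exists v.
  have yj' : `[0, len j]%classic y by exact: subset_itv_oo_cc yj.
  by have [Sv|Sv] := EM (S (source j)); [left|right]; right; exists j => //; exists y.
have disj p : subgraph S p -> subgraph (fun i => ~ S i) p -> False.
  have vtx (v : vert G) : subgraph S (vpt v) -> subgraph (fun i => ~ S i) (vpt v) -> False.
    move=> H1 H2; have Sv := @subgraph_vertex S S_edge v H1.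
    by have := @subgraph_vertex (fun i => ~ S i) nS_edge v H2.
  move=> H1 H2; case: (H1) => [[v _ E]|[j Sj [y + E]]].
    by apply: (vtx v); rewrite -E.
  rewrite /= in_itv /= => jy.
  case: (H2) => [[v _ E']|[k Sk [z + E']]]; first by apply: (vtx v); rewrite -E'.
  rewrite /= in_itv /= => kz.
  have jk : j != k by apply/eqP => jk; apply: Sk; rewrite -jk.
  have [|v Ev] := edges_meet jk jy kz; first by rewrite E E'.
  by apply: (vtx v); rewrite -Ev E.
have Hc := @network_connected R n G (network_set G `&` subgraph S).
have : subgraph S (vpt i).
  suff [] : (network_set G `&` subgraph S) (vpt i) by [].
  rewrite Hc; first by left; exists i.
  - by exists (vpt i0); split; left; exists i0.
  - exists (~` subgraph (fun i => ~ S i)); first exact/closed_openC/subgraph_closed.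
    apply/seteqP; split=> p [Gp Hp]; split=> //; first by move=> /(disj p Hp).
    by case: (cover p Gp) => // /Hp.
  - by exists (subgraph S) => //; exact: subgraph_closed.
exact: subgraph_vertex.
Qed.

(** Every point of the network lies on a closed edge. *)
Lemma network_set_edge p : network_set G p ->
  exists j y, 0 <= y <= len j /\ par j y = p.
Proof.
case=> [[i _ <-]|[j _ [y /=]]]; last first.
  by rewrite in_itv /= => /andP[? ?] <-; exists j, y; rewrite !ltW.
apply: (vertex_connected (S := fun i => exists j y, 0 <= y <= len j /\ par j y = vpt i)).
  move=> j; split=> _; [exists j, (len j)|exists j, 0].
    by rewrite segmentl parl.
  by rewrite segment0 par0.
have [j0 _] := edge_inhabited G.
by exists (source j0), j0, 0; rewrite segment0 par0.
Qed.

(** Points of an open edge near one of its points, or ends, have nearby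
    coordinates. *)
Lemma open_edge_near j y0 d : 0 <= y0 <= len j -> 0 < d ->
  \forall p \near within (open_edge j) (nbhs (par j y0)),
    exists y, [/\ 0 < y < len j, par j y = p & `|y - y0| < d].
Proof.
move=> jy0 d0; rewrite near_withinE.
pose far := par j @` (`[0, len j] `&` ~` ball y0 d).
have nfar : ~ far (par j y0).
  move=> [y [/=]]; rewrite in_itv /= => jy yb E; apply: yb.
  by rewrite (par_eq jy jy0 E); exact: ballxx.
have : nbhs (par j y0) (~` far).
  apply: open_nbhs_nbhs; split=> //; apply: closed_openC.
  by apply: closed_edge_closed; apply: open_closedC; exact: ball_open.
apply: filterS => p pfar [y + E]; rewrite /= in_itv /= => /andP[y0' yl].
exists y; split=> //; first by rewrite y0' yl.
rewrite ltNge; apply/negP => yd; apply: pfar; exists y => //; split=> /=.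
  by rewrite in_itv /= !ltW.
by rewrite /ball /= distrC ltNge yd.
Qed.

(** The ends of an edge are limits of points of the open edge. *)
Lemma open_edge_proper j y0 : 0 <= y0 <= len j ->
  ProperFilter (within (open_edge j) (nbhs (par j y0))).
Proof.
move=> jy0; apply: within_nbhs_proper => B HB.
have /subspace_continuousP/(_ y0) := @par_continuous R n G j.
rewrite /= in_itv /= => /(_ jy0)/(_ B HB).
move=> /nbhs_ballP[d /= d0 Hd].
have [y [y1 yd]] : exists y, 0 < y < len j /\ `|y0 - y| < d.
  pose m := Num.min d (len j).
  have m0 : 0 < m by rewrite lt_min d0 len_gt0.
  have m1 : m <= d by rewrite ge_min lexx.
  have m2 : m <= len j by rewrite ge_min lexx orbT.
  move/andP: jy0 => [h1 h2]; have [yl|yl] := leP y0 (len j / 2).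
    by exists (y0 + m / 4); split; [|rewrite ltr_norml]; apply/andP; split; lra.
  by exists (y0 - m / 4); split; [|rewrite ltr_norml]; apply/andP; split; lra.
exists (par j y); split; first by exists y => //=; rewrite in_itv.
by apply: Hd => //=; move/andP: y1 => [? ?]; rewrite in_itv /= !ltW.
Qed.

(** The sum of the oriented derivatives at a vertex is the flux. *)
Lemma oriented_derivativeE u (F F' : edge G -> R -> R) i :
  (forall j, has_deriv (F j) (F' j)) ->
  (forall j y, 0 <= y <= len j -> F j y = restr u j y) ->
  \sum_(j : edge G | incident i j) oriented_derivative u i j =
    flux source target len F' i.
Proof.
move=> dF FE.
(* sg is the direction along the edge pointing from its end y0 into it *)
have main j y0 (sg : R) : (y0 = 0 /\ sg = 1) \/ (y0 = len j /\ sg = -1) ->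
    par j y0 = vpt i -> oriented_derivative u i j = sg * F' j y0.
  move=> y0sg vi; rewrite /oriented_derivative -vi.
  have jy0 : 0 <= y0 <= len j.
    by case: y0sg => [[-> _]|[-> _]]; [exact: segment0|exact: segmentl].
  have PF := open_edge_proper jy0.
  apply: cvg_lim; first exact: Rhausdorff.
  apply/cvgrPdist_lt => e e0.
  have [dFy EF] := dF j y0.
  have /cvgrPdist_lt/(_ e e0)[d /= d0 Hd] := dFy.
  apply: filterS (open_edge_near jy0 d0) => p [y [/andP[y0' yl] <- yd]].
  have jy : 0 <= y <= len j by rewrite !ltW.
  rewrite !edge_coordK// -!FE//.
  have yy0 : y - y0 != 0.
    by rewrite subr_eq0; case: y0sg => [[-> _]|[-> _]]; [rewrite gt_eqF|rewrite lt_eqF].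
  have := Hd (y - y0); rewrite /= sub0r normrN => /(_ yd yy0).
  rewrite /GRing.scale /= mulr1 subrK -/('D_1 (F j) y0) EF.
  set D := F' j y0 - _ => HD.
  suff -> : sg * F' j y0 - (F j y - F j y0) / `|y - y0| = sg * D.
    by case: y0sg => [[_ ->]|[_ ->]]; rewrite ?mul1r// mulN1r normrN.
  have -> : `|y - y0| = sg * (y - y0).
    case: y0sg => [[-> ->]|[-> ->]]; first by rewrite subr0 mul1r gtr0_norm.
    by rewrite mulN1r opprB distrC gtr0_norm// subr_gt0.
  by rewrite /D; case: y0sg => [[_ ->]|[_ ->]]; field.
rewrite (bigID (fun j => source j == i)) /= /flux -sumrN; congr (_ + _).
  apply: eq_big => j; first by rewrite incidentE; case: (source j == i); rewrite ?andbF.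
  move=> /andP[_ /eqP si]; rewrite -[RHS]mul1r.
  by apply: main; [left|rewrite par0 si].
apply: eq_big => j.
  rewrite incidentE; have := source_target j.
  by case: (source j =P i) => [->|] /=; [rewrite eq_sym => /negbTE ->|rewrite andbT].
move=> /andP[+ /negbTE sn]; rewrite incidentE sn /= => /eqP ti; rewrite -[RHS]mulN1r.
by apply: main; [right|rewrite parl ti].
Qed.

End Bridge.

(** * From networks to metric graphs and back *)

Section Transfer.
Context {R : realType} {n : nat} (G : network R n).
Implicit Types (i : vert G) (j k : edge G).
Variable h : 'rV[R]_n -> R.
Hypothesis h_cont : network_continuous G h.
Local Notation len := (@len R n G).
Local Notation source := (@source R n G).
Local Notation target := (@target R n G).

Let len_pos j : 0 < len j := @len_gt0 R n G j.

(** The restriction of h to the edge j, extended by constants. *)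
Definition edge_datum j (y : R) : R := restr h j (clamp (len j) y).

Lemma edge_datumE j y : 0 <= y <= len j -> edge_datum j y = restr h j y.
Proof. by move=> jy; rewrite /edge_datum clamp_id. Qed.

Lemma edge_datum_continuous j : continuous (edge_datum j).
Proof. by apply: continuous_clamp; [exact: ltW|exact: h_cont.1]. Qed.

Lemma open_itvE (l y : R) : (y \in `]0, l[) = (0 < y < l).
Proof. by rewrite in_itv. Qed.

Lemma continuous_add_exp (c : R) (a u : R -> R) : continuous a ->
  continuous u -> continuous (fun y => c - a y * expR (u y)).
Proof.
move=> ca cu; have ce : continuous (fun y => expR (u y)).
  by move=> y; apply: continuous_comp; [exact: cu|exact: continuous_expR].
move=> y; apply: cvgB; first exact: cvg_cst.
by apply: cvgM; [exact: ca|exact: ce].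
Qed.

Lemma KW_solvable_graph c : KW_solvable G h c ->
  graph_KW source target len edge_datum c.
Proof.
move=> [u [[[uc vc] u2] ueq _ kir]].
pose g j y := c - edge_datum j y * expR (restr u j (clamp (len j) y)).
have /choice[F /choice[F' HF]] : forall j, exists F F', [/\ has_deriv F F',
    has_deriv F' (g j) & forall y, 0 <= y <= len j -> F y = restr u j y].
  move=> j; have [u20 u21 u22 _] := u2 j; apply: C2_extension => //.
    apply: continuous_add_exp; first exact: edge_datum_continuous.
    by apply: continuous_clamp => //; exact: ltW.
  move=> y yj; have := yj; rewrite open_itvE => /andP[y0 yl].
  by rewrite ueq// /g clamp_id ?edge_datumE ?ltW.
have FE j y : 0 <= y <= len j -> F j y = restr u j y by case: (HF j) => _ _; exact.
exists (fun i => u (vpt i)), F, F', g; split; last first.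
  by move=> j y jy; rewrite /g clamp_id// FE.
split; last first.
  move=> i; rewrite -(oriented_derivativeE i (u := u) (F := F)) ?kir// => j.
  by case: (HF j).
split=> j.
- by case: (HF j).
- by case: (HF j).
- by rewrite FE ?segment0// /restr par0.
- by rewrite FE ?segmentl// /restr parl.
Qed.

Lemma par_edge_coord i j : incident i j -> par j (edge_coord j (vpt i)) = vpt i.
Proof.
rewrite /incident => /orP[] /eqP <-; rewrite edge_coordK ?segment0 ?segmentl//.
Qed.

(** Edgewise functions that agree at the vertices glue to a function on the
    network. *)
Lemma network_glue (x : vert G -> R) (U : edge G -> R -> R) :
  (forall j, U j 0 = x (source j)) -> (forall j, U j (len j) = x (target j)) ->
  exists u : 'rV[R]_n -> R, forall j y, 0 <= y <= len j -> restr u j y = U j y.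
Proof.
move=> U0 Ul.
pose P p := [set r | exists j y, [/\ 0 <= y <= len j, par j y = p & r = U j y]].
exists (fun p => xget 0 (P p)) => j y jy; apply: xget_unique.
  by exists j, y.
move=> r [k [z [kz E ->]]]; have [jk|jk] := eqVneq j k.
  by subst k; rewrite (par_eq kz jy E).
have [v Ev] := edges_meet jk jy kz (esym E).
have vertexE l t : 0 <= t <= len l -> par l t = vpt v -> U l t = x v.
  by move=> lt /(par_vertex lt)[[-> <-]|[-> <-]].
by rewrite (vertexE k z)// ?(vertexE j y)// E.
Qed.

Lemma graph_KW_solvable c : graph_KW source target len edge_datum c ->
  KW_solvable G h c.
Proof.
move=> [x [U [U' [U'' [[[d1 d2 U0 Ul] fl] EU]]]]].
have [u uE] := network_glue U0 Ul; exists u.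
have vc : vertex_compatible G u.
  by move=> i j k ij ik; rewrite /restr !par_edge_coord.
have nearE j y : 0 < y < len j -> \forall z \near y, 0 < z < len j.
  move=> yj; have : nbhs y `]0, len j[%classic.
    by apply: near_in_itvoo; rewrite in_itv.
  by apply: filterS => z; rewrite /= in_itv.
have ur j y : 0 < y < len j -> is_derive y 1 (restr u j) (U' j y).
  move=> yj; apply: near_eq_is_derive (d1 j y).
  by apply: filterS (nearE j y yj) => z /andP[? ?]; rewrite uE// !ltW.
have ur1 j y : 0 < y < len j -> derive1 (restr u j) y = U' j y.
  by move=> yj; rewrite derive1E; case: (ur j y yj).
have ur' j y : 0 < y < len j -> is_derive y 1 (derive1 (restr u j)) (U'' j y).
  move=> yj; apply: near_eq_is_derive (d2 j y).
  by apply: filterS (nearE j y yj) => z zj; rewrite ur1.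
have ur2 j y : 0 < y < len j -> derive1n 2 (restr u j) y = U'' j y.
  by move=> yj; rewrite derive1nS /= derive1E; case: (ur' j y yj).
have uc j : {within `[0, len j], continuous (restr u j)}.
  apply: (subspace_eq_continuous (f := U j)).
    move=> y; rewrite inE => jy; apply/esym/uE.
    by move: jy; rewrite /= in_itv.
  exact/continuous_subspaceT/(has_deriv_continuous (d1 j)).
split=> //.
- split=> // j; split=> //.
  + by move=> y; rewrite open_itvE => /(ur j y)[].
  + by move=> y; rewrite open_itvE => /(ur' j y)[].
  + case=> [//|[|[|//]]] _.
      exists (U' j); split; last first.
        by move=> y; rewrite open_itvE => /(ur1 j y).
      exact/continuous_subspaceT/(has_deriv_continuous (d2 j)).
    exists (fun y => c - edge_datum j y * expR (U j y)); split.
      apply/continuous_subspaceT/continuous_add_exp.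
        exact: edge_datum_continuous.
      exact: has_deriv_continuous (d1 j).
    by move=> y; rewrite open_itvE => yj; rewrite ur2// EU//; case/andP: yj => *; rewrite !ltW.
- move=> j y; rewrite open_itvE => yj; rewrite ur2//.
  have jy : 0 <= y <= len j by case/andP: yj => *; rewrite !ltW.
  by rewrite EU// edge_datumE// uE.
- move=> i; rewrite (oriented_derivativeE i (F := U) (F' := U'))//.
  by move=> j y jy; rewrite uE.
Qed.

Lemma network_integralE (H : edge G -> R -> R) :
  (forall j, has_deriv (H j) (edge_datum j)) ->
  network_integral G h = graph_integral len H.
Proof.
move=> dH; apply: eq_bigr => j _.
rewrite /Rintegral (@continuous_FTC2 R (restr h j) (H j) 0 (len j))//=.
- exact: h_cont.1.
- have cH := has_deriv_continuous (dH j).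
  split=> [y _||]; first by case: (dH j y).
    by apply: cvg_at_right_filter; exact: cH.
  by apply: cvg_at_left_filter; exact: cH.
- move=> y; rewrite open_itvE => /andP[? ?].
  by rewrite derive1E; case: (dH j y) => _ ->; rewrite edge_datumE// !ltW.
Qed.

End Transfer.

(** * The threshold *)

Theorem theorem5p1 (R : realType) (n : nat) (G : network R n)
    (h : 'rV[R]_n -> R) (h_cont : network_continuous G h) :
  [/\ (exists2 c : R, c < 0 & KW_solvable G h c) -> network_integral G h < 0,
      network_integral G h < 0 -> exists ch : \bar R, KW_threshold G h ch &
      network_integral G h < 0 ->
        forall ch : \bar R, KW_threshold G h ch ->
          (ch = -oo%E <-> (forall x, network_set G x -> h x <= 0))].
Proof.
have [j0 _] := edge_inhabited G.
have hc := edge_datum_continuous h_cont.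
have /choice[H dH] := fun j => antiderivative (hc j).
have IE := network_integralE h_cont dH.
have lp := @len_gt0 R n G.
have conn := @vertex_connected R n G.
have to_graph := @KW_solvable_graph R n G h h_cont.
have of_graph := @graph_KW_solvable R n G h h_cont.
split.
- move=> [c c0 /to_graph gc]; rewrite IE.
  exact: (graph_KW_integral_lt0 lp j0 dH c0 gc).
- rewrite IE => I0.
  pose sols := [set c%:E | c in [set c : R | c < 0 /\ KW_solvable G h c]].
  have [c0 c00 gc0] := graph_KW_small lp j0 conn hc dH I0.
  exists (ereal_inf sols); split.
  + apply: le_lt_trans (ereal_inf_lbound _) (_ : c0%:E < 0)%E.
      by exists c0 => //; split=> //; exact: of_graph.
    by rewrite lte_fin.
  + move=> c /ereal_inf_lt[_ [c1 [c10 /to_graph g1] <-]]; rewrite lte_fin => c1c cn.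
    by apply/of_graph/(graph_KW_up lp j0 conn hc (ltW c1c) cn).
  + move=> c cinf sc; move: (cinf); apply/negP; rewrite -leNgt.
    apply: ereal_inf_lbound; exists c => //; split=> //.
    rewrite -lte_fin; apply: lt_le_trans cinf _.
    by apply: le_trans (ereal_inf_lbound _) (_ : c0%:E <= 0)%E;
      [exists c0 => //; split=> //; exact: of_graph|rewrite lee_fin ltW].
- rewrite IE => I0 ch [ch0 solv unsolv]; split=> [chE x /network_set_edge|h0].
    move=> [j [y [jy <-]]]; rewrite leNgt; apply/negP => hpos.
    have hjy : 0 < edge_datum h j y by rewrite edge_datumE.
    have [c c0] := graph_KW_unsolvable (@source R n G) (@target R n G) lp hc jy hjy.
    by apply; apply/to_graph/solv => //; rewrite chE ltNyr.
  apply/eqP; rewrite -leeNy_eq leNgt; apply/negP => chN.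
  have [c cch] : exists c : R, (c%:E < ch)%E.
    case: ch chN ch0 {solv unsolv} => [r _ _||//]; last by [].
    by exists (r - 1); rewrite lte_fin ltrBlDr ltrDl.
  apply: (unsolv c cch); apply: of_graph.
  apply: (graph_KW_nonpositive lp j0 conn hc dH I0) => [j y jy|].
    rewrite edge_datumE//; apply: h0.
    have := jy; case/andP => y0 yl; have [->|yn0] := eqVneq y 0.
      by left; exists (source j) => //; rewrite par0.
    have [->|ynl] := eqVneq y (len j).
      by left; exists (target j) => //; rewrite parl.
    right; exists j => //; exists y => //=.
    by rewrite in_itv /= !lt_neqAle y0 yl ynl eq_sym yn0.
  by rewrite -lte_fin; exact: lt_trans ch0.
Qed.
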